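(* Let $n$ be a positive integer. The posets $\mathrm{WO}(\mathrm{Tot})$ (the weak order on total orders of $\mathbb{Z}$), $\mathrm{WO}(\mathrm{TTot}_n)$ (the weak order on translation-invariant total orders of $\mathbb{Z}$), and $\mathrm{Dyer}(\widetilde{S}_n)$ (the extended weak order of the affine symmetric group $\widetilde S_n$) are profinite semidistributive lattices.
   Context: $\mathrm{Tot}$ is the set of all (strict) total orders $\prec$ on $\mathbb{Z}$; $<$ always denotes the usual order. An inversion of $\prec$ is a pair $(a,b)$ of integers with $a<b$ and $b\prec a$; $N(\prec)$ is the set of inversions. $\mathrm{WO}(\mathrm{Tot})$ is $\mathrm{Tot}$ partially ordered by $(\prec_1)\le(\prec_2)$ iff $N(\prec_1)\subseteq N(\prec_2)$. $\mathrm{TTot}_n\subseteq \mathrm{Tot}$ is the set of total orders $\prec$ (called TITOs) such that for all $a,b$: $a\prec b$ iff $a+n\prec b+n$; $\mathrm{WO}(\mathrm{TTot}_n)$ is $\mathrm{TTot}_n$ with the order induced from $\mathrm{WO}(\mathrm{Tot})$. Positive root system of $\widetilde S_n$: let $V$ be the real vector space with basis $\widetilde e_1,\dots,\widetilde e_n,\delta$, and put $\widetilde e_{i+kn}=\widetilde e_i+k\delta$ for $1\le i\le n$, $k\in\mathbb{Z}$, and $\widetilde\alpha_{a,b}=\widetilde e_b-\widetilde e_a$. Then $\Phi^+=\{\widetilde\alpha_{a,b}\mid a<b,\ a\not\equiv b \bmod n\}\subseteq V$. A subset $X\subseteq\Phi^+$ is closed if whenever $\alpha,\beta\in X$, $\gamma\in\Phi^+$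 and $\gamma\in\mathbb{R}_{\ge0}\alpha+\mathbb{R}_{\ge0}\beta$, then $\gamma\in X$; it is biclosed if both $X$ and $\Phi^+\setminus X$ are closed. $\mathrm{Dyer}(\widetilde S_n)$ is the poset of biclosed subsets of $\Phi^+$ ordered by containment. A complete lattice congruence on a complete lattice $L$ is an equivalence relation $\equiv$ such that $x_i\equiv y_i$ for all $i\in I$ ($I$ any index set) implies $\bigvee_i x_i\equiv\bigvee_i y_i$ and $\bigwedge_i x_i\equiv\bigwedge_i y_i$. It is cofinite if $L/{\equiv}$ is finite. A complete lattice $L$ is profinite if for all $x\neq y$ in $L$ there is a cofinite complete lattice congruence $\equiv$ on $L$ with $x\not\equiv y$. A lattice $L$ is semidistributive if for all $y,z\in L$ and every nonempty finite $X\subseteq L$: if $x\vee y=z$ for all $x\in X$ then $(\bigwedge X)\vee y=z$; and if $x\wedge y=z$ for all $x\in X$ then $(\bigvee X)\wedge y=z$. *)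

(* Defs.v *)
From HB Require Import structures.
From mathcomp Require Import all_boot all_order all_algebra.
From mathcomp Require Import boolp classical_sets cardinality reals.

Set Implicit Arguments.
Unset Strict Implicit.
Unset Printing Implicit Defensive.

Import Order.TTheory GRing.Theory Num.Theory.

Local Open Scope classical_set_scope.
Local Open Scope quotient_scope.
Local Open Scope ring_scope.

Section LatticeTheory.
Context {d : Order.disp_t}.
Implicit Type L : porderType d.

Definition is_lattice L : Prop := forall x y : L,
  supremums [set x; y] !=set0 /\ infimums [set x; y] !=set0.

Definition is_complete_lattice L : Prop := forall A : set L,
  supremums A !=set0 /\ infimums A !=set0.

(* Joins and meets are handled relationally: [supremums A u] says that [u] is
   the (unique) join of [A]. *)
Definition complete_lattice_congruence L (e : equiv_rel L) : Prop :=
  forall (I : Type) (x y : I -> L), (forall i, e (x i) (y i)) ->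
    (forall u v, supremums (range x) u -> supremums (range y) v -> e u v) /\
    (forall u v, infimums (range x) u -> infimums (range y) v -> e u v).

Definition cofinite L (e : equiv_rel L) : Prop :=
  finite_set [set: {eq_quot e}].

Definition profinite L : Prop :=
  is_complete_lattice L /\
  forall x y : L, x <> y ->
    exists e : equiv_rel L,
      [/\ complete_lattice_congruence e, cofinite e & ~ e x y].

Definition semidistributive L : Prop :=
  is_lattice L /\
  forall (y z : L) (X : set L), X !=set0 -> finite_set X ->
    ((forall x, X x -> supremums [set x; y] z) ->
       forall m, infimums X m -> supremums [set m; y] z) /\
    ((forall x, X x -> infimums [set x; y] z) ->
       forall j, supremums X j -> infimums [set j; y] z).

Definition profinite_semidistributive_lattice L : Prop :=
  profinite L /\ semidistributive L.

End LatticeTheory.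

Definition strict_total_order (r : rel int) : Prop :=
  [/\ irreflexive r, transitive r & forall a b, a != b -> r a b || r b a].

Record Tot := MkTot {
  Tot_rel :> rel int;
  Tot_relP : `[< strict_total_order Tot_rel >] }.

HB.instance Definition _ := [isSub for Tot_rel].
HB.instance Definition _ := [Choice of Tot by <:].

Definition inversions (p : Tot) : set (int * int) :=
  [set ab | ab.1 < ab.2 /\ p ab.2 ab.1].

Lemma inversions_inj : injective inversions.
Proof.
move=> p q eqN; apply: val_inj => /=; apply/funext => a; apply/funext => b.
have [p0 pt pT] := asboolW (Tot_relP p); have [q0 qt qT] := asboolW (Tot_relP q).
have asym (r : Tot) x y : r x y -> ~~ r y x.
  have [r0 rt _] := asboolW (Tot_relP r).
  by move=> rxy; apply/negP => /(rt _ _ _ rxy); rewrite r0.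
have N x y : x < y -> p y x = q y x.
  move=> xy; have /= E : inversions p (x, y) = inversions q (x, y) by rewrite eqN.
  apply/idP/idP => h.
    have : inversions p (x, y) by [].
    by rewrite E => -[].
  have : inversions q (x, y) by [].
  by rewrite -E => -[].
have [ab|ba|->] := ltgtP a b; [|exact: N|by rewrite p0 q0].
have flip (r : Tot) : r a b = ~~ r b a.
  have [_ _ rT] := asboolW (Tot_relP r).
  apply/idP/idP => [/asym//|]; have := rT _ _ (negbT (lt_eqF ab)).
  by case: (r b a); rewrite ?orbF.
by rewrite !flip N.
Qed.

Definition Tot_le (p q : Tot) : bool := `[< inversions p `<=` inversions q >].

Lemma Tot_le_refl : reflexive Tot_le.
Proof. by move=> p; apply/asboolP. Qed.

Lemma Tot_le_anti : antisymmetric Tot_le.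
Proof.
by move=> p q /andP[/asboolP pq /asboolP qp]; apply/inversions_inj/seteqP.
Qed.

Lemma Tot_le_trans : transitive Tot_le.
Proof.
move=> q p r /asboolP pq /asboolP qr; apply/asboolP.
exact: subset_trans pq qr.
Qed.

Fact weak_order_display : Order.disp_t. Proof. exact: Order.Disp tt tt. Qed.

HB.instance Definition _ := Order.Le_isPOrder.Build weak_order_display Tot
  Tot_le_refl Tot_le_anti Tot_le_trans.

Lemma Tot_leE (p q : Tot) :
  (p <= q)%O = (inversions p `<=` inversions q) :> Prop.
Proof. by rewrite -[LHS]/(is_true `[< _ >]) asboolE. Qed.

Definition translation_invariant (n : nat) (p : Tot) : Prop :=
  forall a b : int, p a b = p (a + n%:Z) (b + n%:Z).

Record TTot (n : nat) := MkTTot {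
  TTot_val :> Tot;
  TTot_valP : `[< translation_invariant n TTot_val >] }.

HB.instance Definition _ n := [isSub for @TTot_val n].
HB.instance Definition _ n := [Choice of TTot n by <:].
HB.instance Definition _ n := [SubChoice_isSubPOrder of TTot n by <:
  with weak_order_display].

Lemma TTot_leE n (p q : TTot n) :
  (p <= q)%O = (inversions p `<=` inversions q) :> Prop.
Proof. by rewrite -[LHS]/(is_true `[< _ >]) asboolE. Qed.

Section RootSystem.
Variables (R : realType) (n : nat).

Local Notation V := 'rV[R]_(n + 1).

Definition delta : V := delta_mx 0 (rshift n 0).

(* The last coordinate is the coefficient of [delta], and the basis
   vector of index [i : 'I_n] is e_(i + 1).  An integer [a] is written
   [i + 1 + k * n] with [0 <= i < n], so that [k] is the floor of
   [(a - 1) / n]. *)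
Definition etilde (a : int) : V :=
  \sum_(i < n | (i%:Z + 1 == a %[mod n])%Z) delta_mx 0 (lshift 1 i)
  + ((a - 1) %/ n)%Z%:~R *: delta.

Lemma etilde_basis (i : 'I_n) : etilde (i%:Z + 1) = delta_mx 0 (lshift 1 i).
Proof.
rewrite /etilde addrK divz_nat divn_small// scale0r addr0 (big_pred1 i)// => j.
by rewrite eqz_modDr !modz_nat !modn_small.
Qed.

Lemma etilde_shift (a k : int) : (0 < n)%N ->
  etilde (a + k * n) = etilde a + k%:~R *: delta.
Proof.
move=> n_gt0; rewrite /etilde -[RHS]addrA -scalerDl -intrD.
congr (_ + _%:~R *: _); first by apply: eq_bigl => i; rewrite [a + _]addrC modzMDl.
have n_neq0 : n%:Z != 0 by rewrite eqz_nat -lt0n.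
by rewrite addrAC [a - 1 + _]addrC divzMDl// addrC.
Qed.

Definition alpha (a b : int) : V := etilde b - etilde a.

Definition positive_roots : set V :=
  [set v | exists a b : int,
    [/\ a < b, (a != b %[mod n])%Z & v = alpha a b]].

Definition closed_roots (X : set V) : Prop :=
  forall u v w : V, X u -> X v -> positive_roots w ->
    (exists s t : R, [/\ 0 <= s, 0 <= t & w = s *: u + t *: v]) -> X w.

Definition biclosed (X : set V) : Prop :=
  [/\ X `<=` positive_roots, closed_roots X &
      closed_roots (positive_roots `\` X)].

Record Dyer := MkDyer {
  Dyer_set :> set V;
  Dyer_setP : `[< biclosed Dyer_set >] }.

HB.instance Definition _ := [isSub for Dyer_set].
HB.instance Definition _ := [Choice of Dyer by <:].
HB.instance Definition _ := [SubChoice_isSubPOrder of Dyer by <: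
  with weak_order_display].

Lemma Dyer_leE (X Y : Dyer) : (X <= Y)%O = (Dyer_set X `<=` Dyer_set Y) :> Prop.
Proof. by rewrite -subsetEset. Qed.

End RootSystem.

(* Main.v *)
(** In [WO(Tot)] the inversion set of a join is the transitive closure of the
union of the inversion sets, and reversing orders is an anti-automorphism.  A
chain of inversions from [a] to [b] stays in [[a, b]], so agreeing on the pairs
of a finite window is a complete congruence with finitely many classes; these
congruences separate points.  Semidistributivity follows by looking at a
shortest inversion of the join that is missed.  All of this restricts to
translation-invariant orders (TITOs).

A biclosed set [X] of affine roots determines the order of incongruent
integers, and forces at most one direction on each residue class.  The map from
TITOs to their real inversion sets thus has a section taking [X] to the least
TITO over [X]; this section is left adjoint, and the greatest TITO is right
adjoint.  Hence joins, meets and semidistributivity pass to [Dyer].  For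
profiniteness, a chain of inversions of TITOs between incongruent integers can
be replaced, without leaving the same interval, by one between consecutively
incongruent integers, so windows give congruences of [Dyer] too. *)

Require Import Defs.
From mathcomp Require Import all_boot all_order all_algebra.
From mathcomp Require Import boolp classical_sets cardinality reals.
From mathcomp Require Import zify lra.
From Stdlib Require Import Relation_Operators.

Set Implicit Arguments.
Unset Strict Implicit.
Unset Printing Implicit Defensive.

Import Order.TTheory GRing.Theory Num.Theory.

Local Open Scope classical_set_scope.
Local Open Scope quotient_scope.
Local Open Scope ring_scope.

(** * Self-dual lattices and systems of inversions *)

Lemma clos_trans_first (T : Type) (S : T -> T -> Prop) a b :
  clos_trans _ S a b -> S a b \/ exists2 c, S a c & clos_trans _ S c b.
Proof.
elim=> {a b} [a b|a c b _ [ac|[d ad dc]] cb _]; first by left.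
  by right; exists c.
by right; exists d => //; exact: t_trans cb.
Qed.

Lemma clos_trans_last (T : Type) (S : T -> T -> Prop) a b :
  clos_trans _ S a b -> S a b \/ exists2 c, clos_trans _ S a c & S c b.
Proof.
elim=> {a b} [a b|a c b ac _ _ [cb|[d cd db]]]; first by left.
  by right; exists c.
by right; exists d => //; exact: t_trans cd.
Qed.

Lemma clos_trans_lt (S : int -> int -> Prop) a b :
  (forall x y, S x y -> x < y) -> clos_trans _ S a b -> a < b.
Proof. by move=> lS; elim=> [x y /lS//|x y z _ + _]; apply: lt_trans. Qed.

(** Steps increase, so every vertex of a chain from [a] to [b] lies in [a, b] and hence in
    [lo, hi]. *)
Lemma clos_trans_within (S T : int -> int -> Prop) (lo hi a b : int) :
  (forall x y, S x y -> x < y) ->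
  (forall x y, lo <= x -> y <= hi -> S x y -> T x y) ->
  lo <= a -> b <= hi -> clos_trans _ S a b -> clos_trans _ T a b.
Proof.
move=> lS ST + + h; elim: h => {a b} [x y xy lx yh|x y z xy IH1 yz IH2 lx zh].
  exact/t_step/ST.
have := clos_trans_lt lS xy; have := clos_trans_lt lS yz => lyz lxy.
by apply: t_trans (IH1 _ _) (IH2 _ _); lia.
Qed.

(** The set [X] may be infinite here; the meet half is recovered from this one through an
    order-reversing involution. *)
Definition join_semidistributive {d : Order.disp_t} (L : porderType d) : Prop :=
  forall (y z : L) (X : set L), X !=set0 ->
    (forall x, X x -> supremums [set x; y] z) ->
    forall m, infimums X m -> supremums [set m; y] z.

Section Duality.
Context {d : Order.disp_t} {L : porderType d} (rev : L -> L).
Hypothesis revK : involutive rev.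
Hypothesis rev_le : forall x y, (rev x <= rev y)%O = (y <= x)%O.

Lemma supremums_rev (A : set L) u :
  supremums (rev @` A) (rev u) <-> infimums A u.
Proof.
have E v : ubound (rev @` A) v <-> lbound A (rev v).
  split=> [h x Ax|h _ [x Ax <-]]; rewrite -rev_le revK; first exact/h/imageP.
  exact: h.
split=> -[h1 h2]; split.
- by rewrite -[u]revK; apply/E.
- by move=> v hv; rewrite -rev_le; apply/h2/E; rewrite revK.
- by apply/E; rewrite revK.
- by move=> v /E hv; rewrite -rev_le revK; apply: h2.
Qed.

Lemma infimums_rev (A : set L) u :
  infimums (rev @` A) (rev u) <-> supremums A u.
Proof.
have E : rev @` (rev @` A) = A.
  by rewrite image_comp (_ : rev \o rev = id) ?image_id//; apply/funext.
by rewrite -{2}[u]revK -{2}E supremums_rev.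
Qed.

Lemma complete_lattice_of_sups :
  (forall A : set L, supremums A !=set0) -> is_complete_lattice L.
Proof.
move=> h A; split=> //; have [u hu] := h (rev @` A).
by exists (rev u); apply/supremums_rev; rewrite revK.
Qed.

Lemma image_rev2 x y : rev @` [set x; y] = [set rev x; rev y].
Proof. by rewrite image_setU !image_set1. Qed.

Lemma semidistributive_of_join :
  is_complete_lattice L -> join_semidistributive L -> semidistributive L.
Proof.
move=> cL jL; split=> [x y|y z X X0 _]; first exact: cL.
split=> [h m hm|h j hj]; first exact: (jL y z X).
apply/supremums_rev; rewrite image_rev2.
apply: (jL _ _ (rev @` X)); first exact: image_nonempty.
  by move=> _ [x Xx <-]; rewrite -image_rev2; apply/supremums_rev/h.
exact/infimums_rev.
Qed.

End Duality.

(** * Posets encoded by inversion sets; [Q] is trivial for total orders and incongruence for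
    [Dyer] *)

Section InversionSystem.
Context {d : Order.disp_t} {L : porderType d}.
Variables (Q : int -> int -> Prop) (I : L -> int -> int -> Prop) (rev : L -> L).
Hypothesis I_lt : forall x a b, I x a b -> a < b.
Hypothesis I_Q : forall x a b, I x a b -> Q a b.
Hypothesis le_I : forall x y, (x <= y)%O <-> (forall a b, I x a b -> I y a b).
Hypothesis I_rev : forall x a b, I (rev x) a b <-> [/\ a < b, Q a b & ~ I x a b].
Hypothesis sup_I : forall A : set L, exists2 u, supremums A u &
  forall a b, I u a b <->
    Q a b /\ clos_trans _ (fun a b => exists2 x, A x & I x a b) a b.

Lemma eq_I x y : (forall a b, I x a b <-> I y a b) -> x = y.
Proof. by move=> h; apply/le_anti/andP; split; apply/le_I => a b /h. Qed.

Lemma I_revK : involutive rev.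
Proof.
move=> x; apply: eq_I => a b; rewrite I_rev; split.
  by case=> ab q; rewrite I_rev => h; apply: contrapT => n; apply: h.
by move=> i; split; [exact: I_lt i|exact: I_Q i|rewrite I_rev => -[]].
Qed.

Lemma le_I_rev x y : (rev x <= rev y)%O = (y <= x)%O.
Proof.
suff h u v : (v <= u)%O -> (rev u <= rev v)%O.
  by apply/idP/idP => [/h|/h//]; rewrite !I_revK.
by move=> /le_I vu; apply/le_I => a b /I_rev[ab q n]; apply/I_rev; split=> // /vu.
Qed.

(** The integers of [-M, M] are indexed by ['I_(M.*2.+1)] after a shift by [M], which makes the
    codomain finite. *)
Definition window (M : nat) (x : L) :
    {ffun 'I_(M.*2.+1) * 'I_(M.*2.+1) -> bool} :=
  [ffun ij : 'I_(M.*2.+1) * 'I_(M.*2.+1) =>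
    `[< I x (ij.1%:Z - M%:Z) (ij.2%:Z - M%:Z) >]].

Lemma windowP M x y : window M x = window M y <->
  forall a b : int, `|a| <= M%:Z -> `|b| <= M%:Z -> (I x a b <-> I y a b).
Proof.
split=> [h a b ha hb|h]; last first.
  apply/ffunP => -[i j]; rewrite !ffunE /=.
  by apply/asbool_equiv_eq/h; have := ltn_ord i; have := ltn_ord j; lia.
have a1 : (absz (a + M%:Z)%R < M.*2.+1)%N by lia.
have b1 : (absz (b + M%:Z)%R < M.*2.+1)%N by lia.
move/ffunP: h => /(_ (Ordinal a1, Ordinal b1)); rewrite !ffunE /=.
have -> : (absz (a + M%:Z)%R)%:Z - M%:Z = a by lia.
have -> : (absz (b + M%:Z)%R)%:Z - M%:Z = b by lia.
by move=> e; split=> /asboolP i; apply/asboolP; rewrite ?e// -e.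
Qed.

Definition window_rel M : rel L := fun x y => window M x == window M y.

Lemma window_rel_refl M : reflexive (window_rel M).
Proof. by move=> x; apply: eqxx. Qed.

Lemma window_rel_sym M : symmetric (window_rel M).
Proof. by move=> x y; apply: eq_sym. Qed.

Lemma window_rel_trans M : transitive (window_rel M).
Proof. by move=> y x z; rewrite /window_rel => /eqP ->. Qed.

Definition window_equiv M : equiv_rel L :=
  EquivRel (window_rel M) (@window_rel_refl M) (@window_rel_sym M)
    (@window_rel_trans M).

Lemma cofinite_window M : cofinite (window_equiv M).
Proof.
have inj : injective (fun q : {eq_quot (window_equiv M)} => window M (repr q)).
  move=> q q' /= h; rewrite -[q]reprK -[q']reprK; apply/eqmodP.
  exact/eqP.
have := @finite_preimage _ _ [set: _] _ (in2W inj) (@finite_finset _ _).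
by rewrite preimage_setT.
Qed.

Lemma window_rev M x y : window M x = window M y ->
  window M (rev x) = window M (rev y).
Proof.
move=> /windowP h; apply/windowP => a b ha hb; rewrite !I_rev.
by split=> -[ab q n]; split=> // i; apply/n/h.
Qed.

(* A chain of inversions from [a] to [b] stays between [a] and [b], hence in
   any window containing them. *)
Lemma window_sup M (A B : set L) u v :
  (forall x, A x -> exists2 y, B y & window M x = window M y) ->
  supremums A u -> supremums B v ->
  forall a b : int, `|a| <= M%:Z -> `|b| <= M%:Z -> I u a b -> I v a b.
Proof.
move=> AB su sv a b.
have [u' su' Iu] := sup_I A; have [v' sv' Iv] := sup_I B.
rewrite (is_subset1_supremums su su') (is_subset1_supremums sv sv').
move=> ha hb /Iu [q h]; apply/Iv; split=> // {q su sv su' sv' Iu Iv}.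
set S := fun a b => exists2 x, B x & I x a b.
apply: (clos_trans_within (lo := - M%:Z) (hi := M%:Z) _ _ _ _ h); try lia.
  by move=> x y [? _ /I_lt].
move=> x y lx yh [t At xy]; have [t' Bt' /windowP e] := AB t At.
have lt_xy := I_lt xy.
by exists t' => //; apply/e => //; lia.
Qed.

Lemma profinite_inversions : is_complete_lattice L /\ profinite L.
Proof.
have cL : is_complete_lattice L.
  apply: (complete_lattice_of_sups I_revK le_I_rev) => A.
  by have [u su _] := sup_I A; exists u.
split=> //; split=> // x y neq_xy.
have [a [b nab]] : exists a b, ~ (I x a b <-> I y a b).
  apply: contrapT => h; apply: neq_xy; apply: eq_I => a b.
  by apply: contrapT => n; apply: h; exists a, b.
(* Any window containing both ends of the distinguishing pair separates [x] from [y]. *)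
pose M := (absz a + absz b)%N.
exists (window_equiv M); split; last 1 first.
- by move=> /eqP/windowP h; apply/nab/h; rewrite /M; lia.
- have sup_eq (J : Type) (f g : J -> L) u v :
      (forall j, window M (f j) = window M (g j)) ->
      supremums (range f) u -> supremums (range g) v -> window M u = window M v.
    move=> fg su sv; apply/windowP => a' b' ha hb.
    split; [apply: (window_sup _ su sv ha hb)|apply: (window_sup _ sv su ha hb)].
      by move=> _ [j _ <-]; exists (g j) => //; exists j.
    by move=> _ [j _ <-]; exists (f j) => //; exists j.
  have range_comp (J : Type) (f : J -> L) :
      range (rev \o f) = rev @` range f by rewrite image_comp.
  move=> J f g /= fg.
  have {}fg j : window M (f j) = window M (g j) by apply/eqP; exact: fg.
  split=> u v su sv; apply/eqP; first exact: sup_eq fg su sv.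
  (* Meets are joins of reversed elements, and reversal respects windows. *)
  rewrite -[u]I_revK -[v]I_revK; apply: window_rev.
  apply: (sup_eq _ (rev \o f) (rev \o g)).
  + by move=> j; exact: window_rev.
  + by rewrite range_comp; apply/(supremums_rev I_revK le_I_rev).
  + by rewrite range_comp; apply/(supremums_rev I_revK le_I_rev).
- exact: cofinite_window.
Qed.

End InversionSystem.

(** * The weak order on total orders *)

Section TotalOrders.
Implicit Type p : Tot.

Lemma Tot_irr p a : p a a = false.
Proof. by have [h _ _] := asboolW (Tot_relP p). Qed.

Lemma Tot_trans p b a c : p a b -> p b c -> p a c.
Proof. by have [_ h _] := asboolW (Tot_relP p); apply: h. Qed.

Lemma Tot_asym p a b : p a b -> p b a -> False.
Proof. by move=> /Tot_trans h /h; rewrite Tot_irr. Qed.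

Lemma Tot_flip p a b : a != b -> ~ p a b -> p b a.
Proof.
by have [_ _ h] := asboolW (Tot_relP p); move=> /h /orP[].
Qed.

Definition inv p (a b : int) : Prop := inversions p (a, b).

Lemma inv_lt p a b : inv p a b -> a < b. Proof. by case. Qed.

Lemma inv_trans p a b c : inv p a b -> inv p b c -> inv p a c.
Proof.
move=> [/= ab pba] [/= bc pcb]; split=> /=; first exact: lt_trans bc.
exact: Tot_trans pba.
Qed.

Lemma inv_cotrans p a b c :
  a < b -> b < c -> inv p a c -> inv p a b \/ inv p b c.
Proof.
move=> ab bc [/= ac pca]; have [pba|npba] := boolP (p b a); [by left|right].
split=> //=; apply: Tot_trans pca _; apply: Tot_flip; last exact/negP.
by rewrite gt_eqF.
Qed.

Lemma le_inv p q : (p <= q)%O <-> (forall a b, inv p a b -> inv q a b).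
Proof. by rewrite Tot_leE; split=> [h a b|h [a b]]; apply: h. Qed.

Lemma exists_Tot_rel (r : int -> int -> Prop) :
  (forall a, ~ r a a) -> (forall a b c, r a b -> r b c -> r a c) ->
  (forall a b, a != b -> r a b \/ r b a) ->
  exists p, forall a b, p a b <-> r a b.
Proof.
move=> r0 rt rT.
have rP : `[< strict_total_order (fun a b => `[< r a b >]) >].
  apply/asboolP; split=> [a|b a c|a b /rT]; first by apply/asboolP.
    by move=> /asboolP ab /asboolP /(rt _ _ _ ab) ?; apply/asboolP.
  by case=> ?; apply/orP; [left|right]; apply/asboolP.
by exists (MkTot rP) => a b /=; split=> [/asboolP|/asboolP].
Qed.

(** The order reverses [<] exactly on the pairs of [N]. Its transitivity, split by the usual order
    of the three integers, amounts to transitivity of [N] and of its complement. *)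
Lemma exists_Tot_inv (N : int -> int -> Prop) :
  (forall a b, N a b -> a < b) ->
  (forall a b c, N a b -> N b c -> N a c) ->
  (forall a b c, a < b -> b < c -> N a c -> N a b \/ N b c) ->
  exists p, forall a b, inv p a b <-> N a b.
Proof.
move=> Nlt Nt Nc.
pose r (a b : int) := (a < b /\ ~ N a b) \/ (b < a /\ N b a).
have [|||p pr] := @exists_Tot_rel r.
- by move=> a [] []; rewrite ltxx.
- move=> a b c [[ab nab]|[ba Nba]] [[bc nbc]|[cb Ncb]].
  + left; split; first exact: lt_trans bc.
    by move=> /(Nc _ _ _ ab bc)[].
  + have [ac|ca|eac] := ltgtP a c; last by rewrite eac in nab.
      by left; split=> // Nac; apply/nab/Nt/Ncb.
    by right; split=> //; have [] := Nc _ _ _ ca ab Ncb.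
  + have [ac|ca|eac] := ltgtP a c; last by rewrite -eac in nbc.
      by left; split=> // Nac; apply/nbc/(Nt _ _ _ Nba).
    by right; split=> //; have [] := Nc _ _ _ bc ca Nba.
  + by right; split; [exact: lt_trans ba|exact: Nt Nba].
- move=> a b; rewrite /r neq_lt => /orP[ab|ba].
    by have [|] := pselect (N a b); [right; right|left; left].
  by have [|] := pselect (N b a); [left; right|right; left].
exists p => a b; rewrite /inv /inversions /= pr /r; split.
  by case=> ab [[/(lt_trans ab)]|[]//]; rewrite ltxx.
by move=> n; split; [exact: Nlt|right; split=> //; exact: Nlt].
Qed.

(** The closure is cotransitive because a point between the ends of a chain is either a vertex or
    splits a single step, and single steps are inversions of one order. *)
Lemma exists_Tot_sup (T : Type) (A : set T) (v : T -> Tot) :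
  exists p, forall a b, inv p a b <->
    clos_trans _ (fun a b => exists2 x, A x & inv (v x) a b) a b.
Proof.
apply: exists_Tot_inv.
- by move=> a b; apply: clos_trans_lt => x y [? _ /inv_lt].
- by move=> a b c; apply: t_trans.
move=> a b c + + h; elim: h b => {a c} [a c [x Ax ac] b ab bc|
    a e c ae IH1 ec IH2 b ab bc].
  by have [] := inv_cotrans ab bc ac; [left|right]; apply: t_step; exists x.
have [be|eb|eq_be] := ltgtP b e; last by left; rewrite eq_be.
  by have [|be'] := IH1 _ ab be; [left|right; apply: t_trans ec].
by have [eb'|] := IH2 _ eb bc; [left; apply: t_trans eb'|right].
Qed.

Lemma converse_subproof p : `[< strict_total_order (fun a b => p b a) >].
Proof.
have [p0 pt pT] := asboolW (Tot_relP p).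
apply/asboolP; split=> // [b a c ba cb|a b /pT]; first exact: pt ba.
by rewrite orbC.
Qed.

Definition converse p : Tot := MkTot (converse_subproof p).

Lemma inv_converse p a b : inv (converse p) a b <-> [/\ a < b, True & ~ inv p a b].
Proof.
split=> [[/= ab pab]|[ab _ n]].
  by split=> // -[_ /= pba]; apply: Tot_asym pab pba.
split=> //=; apply: Tot_flip; first by rewrite gt_eqF.
by move=> pba; apply: n.
Qed.

End TotalOrders.

(** * Subposets of [Tot] stable under reversal and joins *)

Section SubposetOfTot.
Context {d : Order.disp_t} {L : porderType d} (v : L -> Tot) (rev : L -> L).
Hypothesis v_le : forall x y, (x <= y)%O <-> (v x <= v y)%O.
Hypothesis v_rev : forall x, v (rev x) = converse (v x).
Hypothesis v_sup : forall (A : set L) (p : Tot),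
  (forall a b, inv p a b <->
    clos_trans _ (fun a b => exists2 x, A x & inv (v x) a b) a b) ->
  exists u, v u = p.

Let le_invv x y : (x <= y)%O <-> (forall a b, inv (v x) a b -> inv (v y) a b).
Proof. by rewrite v_le le_inv. Qed.

Let inv_rev x a b :
  inv (v (rev x)) a b <-> [/\ a < b, True & ~ inv (v x) a b].
Proof. by rewrite v_rev inv_converse. Qed.

Let inv_sup_ex (A : set L) : exists2 u, supremums A u &
  forall a b, inv (v u) a b <-> True /\
    clos_trans _ (fun a b => exists2 x, A x & inv (v x) a b) a b.
Proof.
have [p pA] := exists_Tot_sup A v; have [u up] := v_sup pA; subst p.
exists u => [|a b]; last by rewrite pA; tauto.
split=> [x Ax|y yA]; apply/le_invv => a b.
  by move=> xab; apply/pA/t_step; exists x.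
move=> /pA; elim=> {a b} [a b [x Ax]|a c b _ ac _]; last exact: inv_trans.
by have /le_invv := yA _ Ax; apply.
Qed.

Lemma inv_sup (A : set L) u : supremums A u -> forall a b,
  inv (v u) a b <-> clos_trans _ (fun a b => exists2 x, A x & inv (v x) a b) a b.
Proof.
move=> su a b; have [u' su' h] := inv_sup_ex A.
by rewrite (is_subset1_supremums su su') h; tauto.
Qed.

Lemma profinite_subTot : is_complete_lattice L /\ profinite L.
Proof.
by apply: (profinite_inversions _ _ le_invv inv_rev inv_sup_ex) => // x a b /inv_lt.
Qed.

Let vrevK : involutive rev :=
  I_revK (fun x => @inv_lt (v x)) (fun _ _ _ _ => I) le_invv inv_rev.
Let vrev_le :=
  le_I_rev (fun x => @inv_lt (v x)) (fun _ _ _ _ => I) le_invv inv_rev.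

(* Take [(a, b)] in [N(z)] but not in [N(m \/ y)] with [b - a] minimal.  Each
   [c] strictly between [a] and [b] has exactly one of [(a, c)], [(c, b)] in
   [N(z)], and the same one in every [N(x)].  So no chain of non-inversions of
   elements of [X] leads from [a] to [b], hence [(a, b)] is in [N(m)]. *)
Lemma join_semidistributive_subTot : join_semidistributive L.
Proof.
move=> y z X [x0 Xx0] hX m [m_lb m_glb].
have [w sw iw] := inv_sup_ex [set m; y].
have xz x : X x -> (x <= z)%O by move=> /hX[+ _]; apply; left.
have yz : (y <= z)%O by have [+ _] := hX _ Xx0; apply; right.
have mw : (m <= w)%O by have [+ _] := sw; apply; left.
have yw : (y <= w)%O by have [+ _] := sw; apply; right.
suff -> : z = w by [].
apply/le_anti/andP; split; last first.
  have [_] := sw; apply=> _ [->|->]//.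
  by apply: le_trans (xz _ Xx0); exact: m_lb.
apply/le_invv => a b; have [k] := ubnP (absz (b - a)%R).
elim: k a b => // k IH a b kab zab; apply: contrapT => nwab.
have ab := inv_lt zab.
have wac c : a < c -> c < b -> inv (v z) a c -> inv (v w) a c.
  by move=> ac cb; apply: IH; lia.
have wcb c : a < c -> c < b -> inv (v z) c b -> inv (v w) c b.
  by move=> ac cb; apply: IH; lia.
have excl c : inv (v z) a c -> inv (v z) c b -> False.
  move=> ac cb; apply/nwab/(@inv_trans _ _ c).
    by apply: wac => //; [exact: inv_lt ac|exact: inv_lt cb].
  by apply: wcb => //; [exact: inv_lt ac|exact: inv_lt cb].
have xab x : X x -> inv (v x) a b.
  move=> Xx; have := zab; rewrite (inv_sup (hX x Xx)).
  set S := fun a b => _.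
  have Sz c e : clos_trans _ S c e -> inv (v z) c e.
    by move=> h; apply/(inv_sup (hX x Xx)).
  (* By [excl] the chain has a single step, and that step is not in [y], since [y] lies below
     [w]. *)
  move=> Sab; case: (clos_trans_first Sab) => [[t [->|->]//]|[c ac cb]].
    by move=> yab; case: nwab; move/le_invv: yw; apply.
  by case: (excl c); apply: Sz => //; exact: t_step.
have xzE x : X x -> forall c e, inv (v x) c e -> inv (v z) c e.
  by move=> Xx; apply/le_invv/xz.
have xac x c : X x -> c < b -> inv (v z) a c -> inv (v x) a c.
  move=> Xx cb zac; have ac := inv_lt zac.
  have [//|/(xzE _ Xx)] := inv_cotrans ac cb (xab _ Xx).
  by move=> /(excl _ zac).
have xcb x c : X x -> a < c -> inv (v z) c b -> inv (v x) c b.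
  move=> Xx ac zcb; have cb := inv_lt zcb.
  have [/(xzE _ Xx)|//] := inv_cotrans ac cb (xab _ Xx).
  by move=> /excl/(_ zcb).
(* Reversal turns the meet into a join, so a non-inversion of [m] is a chain of non-inversions of
   members of [X]. *)
have m_inf : supremums (rev @` X) (rev m) by apply/(supremums_rev vrevK vrev_le).
suff mab : inv (v m) a b by apply: nwab; move/le_invv: mw; apply.
apply: contrapT => nmab.
have : inv (v (rev m)) a b by apply/inv_rev.
rewrite (inv_sup m_inf); set S := fun a b => _ => Sab.
(* [B] is an invariant of the chain: it holds at [a], each step preserves it, and it fails at
   [b]. *)
pose B c := c = a \/ inv (v z) c b.
suff : B b by case=> [eb|/inv_lt]; [rewrite eb ltxx in ab|rewrite ltxx].
suff: forall c e, clos_trans _ S c e -> a <= c -> e <= b -> B c -> B e.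
  by move/(_ _ _ Sab); apply=> //; left.
have S_lt c e : S c e -> c < e by move=> [? _ /inv_lt].
move=> c e.
elim=> {c e} [c e Sce ac eb Bc|c f e cf IH1 fe IH2 ac eb Bc]; last first.
  have := clos_trans_lt S_lt cf; have := clos_trans_lt S_lt fe => lfe lcf.
  by apply: IH2 => //; [lia|apply: IH1 => //; lia].
have ce := S_lt _ _ Sce; have ae : a < e by exact: le_lt_trans ce.
case: Sce => _ [x Xx <-] /inv_rev[_ _ nxce].
have [eq_eb|neb] := eqVneq e b.
  subst e; case: Bc => [eca|zcb]; first by case: nxce; rewrite eca; exact: xab.
  case: nxce; have [eca|nca] := eqVneq c a; first by rewrite eca; exact: xab.
  by apply: xcb => //; lia.
have eb' : e < b by lia.
have [zae|zeb] := inv_cotrans ae eb' zab; last by right.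
case: nxce; case: Bc => [->|zcb]; first exact: xac.
have [eca|nca] := eqVneq c a; first by rewrite eca; exact: xac.
have ac' : a < c by lia.
have [_ /= x_bc] := xcb _ _ Xx ac' zcb.
(* In [x], [e] precedes [a], and [a] precedes [c] because otherwise (a, c) would be an inversion of
   [z]; hence (c, e) is an inversion of [x]. *)
have [_ /= x_ea] := xac _ _ Xx eb' zae.
split=> //=; apply: Tot_trans x_ea _; apply: Tot_flip; first by rewrite gt_eqF.
by move=> x_ca; apply: (excl c _ zcb); apply: (xzE _ Xx); split.
Qed.

Lemma subTot_profinite_semidistributive : profinite_semidistributive_lattice L.
Proof.
have [cL pL] := profinite_subTot; split=> //.
apply: (semidistributive_of_join vrevK vrev_le cL).
exact: join_semidistributive_subTot.
Qed.

End SubposetOfTot.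

Lemma Tot_profinite_semidistributive : profinite_semidistributive_lattice Tot.
Proof.
apply: (@subTot_profinite_semidistributive _ Tot id converse) => // A p h.
by exists p.
Qed.

(** * Translation-invariant total orders *)

Section TranslationInvariant.
Variable n : nat.

Lemma TTot_shift (p : TTot n) a b : p (a + n%:Z) (b + n%:Z) = p a b.
Proof. by rewrite -(asboolW (TTot_valP p)). Qed.

Lemma translation_invariant_of_inv (p : Tot) :
  (forall a b, inv p a b -> inv p (a + n%:Z) (b + n%:Z)) ->
  (forall a b, inv p a b -> inv p (a - n%:Z) (b - n%:Z)) ->
  translation_invariant n p.
Proof.
move=> h1 h2.
have E a b : a < b -> p b a = p (b + n%:Z) (a + n%:Z).
  move=> ab; apply/idP/idP => pba.
    by have [_] := h1 a b (conj ab pba).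
  have ab' : a + n%:Z < b + n%:Z by lia.
  by have [_] := h2 _ _ (conj ab' pba); rewrite !addrK.
have flip a b : a < b -> p a b = ~~ p b a.
  move=> ab; apply/idP/idP => [pab|/negP]; last by apply: Tot_flip; rewrite gt_eqF.
  by apply/negP; apply: Tot_asym pab.
move=> a b; have [ab|ba|->] := ltgtP a b; last by rewrite !Tot_irr.
  by rewrite (flip a b)// (E a b)// -flip//; lia.
exact: E.
Qed.

Lemma exists_TTot (p : Tot) : translation_invariant n p ->
  exists q : TTot n, TTot_val q = p.
Proof. by move=> /asboolT h; exists (MkTTot h). Qed.

Lemma TTot_converse_subproof (p : TTot n) :
  `[< translation_invariant n (converse p) >].
Proof. by apply/asboolP => a b /=; rewrite TTot_shift. Qed.

Definition TTot_converse (p : TTot n) : TTot n :=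
  MkTTot (TTot_converse_subproof p).

Lemma clos_trans_shift (S : int -> int -> Prop) (k a b : int) :
  (forall a b, S a b -> S (a + k) (b + k)) ->
  clos_trans _ S a b -> clos_trans _ S (a + k) (b + k).
Proof.
move=> Sk; elim=> {a b} [a b /Sk|a c b _ ac _]; first exact: t_step.
exact: t_trans.
Qed.

Lemma TTot_sup (A : set (TTot n)) (p : Tot) :
  (forall a b, inv p a b <->
    clos_trans _ (fun a b => exists2 x : TTot n, A x & inv x a b) a b) ->
  exists u : TTot n, TTot_val u = p.
Proof.
move=> h; apply/exists_TTot/translation_invariant_of_inv => a b /h pab.
  apply/h/clos_trans_shift; last exact: pab.
  move=> c e [x Ax [/= ce xec]]; exists x => //; split=> /=; first lia.
  by rewrite TTot_shift.
apply/h/clos_trans_shift; last exact: pab.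
move=> c e [x Ax [/= ce xec]]; exists x => //; split=> /=; first lia.
by rewrite -TTot_shift !subrK.
Qed.

Lemma inv_TTot_sup (A : set (TTot n)) (u : TTot n) : supremums A u ->
  forall a b, inv u a b <->
    clos_trans _ (fun a b => exists2 x : TTot n, A x & inv x a b) a b.
Proof.
exact: (@inv_sup _ (TTot n) (@TTot_val n) (fun _ _ => iff_refl _) TTot_sup).
Qed.

Lemma join_semidistributive_TTot : join_semidistributive (TTot n).
Proof.
exact: (@join_semidistributive_subTot _ (TTot n) (@TTot_val n) TTot_converse _ _
  TTot_sup).
Qed.

Lemma TTot_profinite_semidistributive : profinite_semidistributive_lattice (TTot n).
Proof.
exact: (@subTot_profinite_semidistributive _ (TTot n) (@TTot_val n)
  TTot_converse _ _ TTot_sup).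
Qed.

End TranslationInvariant.

(** * Residue classes modulo [n] and their monotonicity in a TITO *)

Section Residues.
Variables (n : nat) (n_gt0 : (0 < n)%N).

Definition cong (a b : int) : bool := (a == b %[mod n])%Z.

Lemma congP (a b : int) : reflect (exists k : int, b = a + k * n%:Z) (cong a b).
Proof.
rewrite /cong eq_sym eqz_mod_dvd; apply: (iffP dvdzP) => -[k e]; exists k.
  by rewrite -e addrC subrK.
by rewrite e addrC addKr.
Qed.

Lemma cong_refl a : cong a a. Proof. exact: eqxx. Qed.

Lemma cong_sym a b : cong a b = cong b a. Proof. exact: eq_sym. Qed.

Lemma cong_trans b a c : cong a b -> cong b c -> cong a c.
Proof. by rewrite /cong => /eqP ->. Qed.

Lemma cong_shiftr (k a b : int) : cong a (b + k * n%:Z) = cong a b.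
Proof. by rewrite /cong [b + _]addrC modzMDl. Qed.

Lemma cong_shiftl (k a b : int) : cong (a + k * n%:Z) b = cong a b.
Proof. by rewrite cong_sym cong_shiftr cong_sym. Qed.

(** Division of [d - c] by [n] leaves a nonzero remainder, so both inequalities are strict. *)
Lemma cong_representative (c d : int) : ~~ cong c d ->
  exists m : int, c < d - m * n%:Z /\ d - m * n%:Z < c + n%:Z.
Proof.
move=> ncd; exists ((d - c) %/ n%:Z)%Z.
have n0 : n%:Z != 0 by rewrite eqz_nat -lt0n.
have := divz_eq (d - c) n%:Z; have := modz_ge0 (d - c) n0.
have := ltz_mod (d - c) n0; set q := (_ %/ _)%Z; set r := (_ %% _)%Z.
move=> rn r0 e; have : r != 0.
  by apply: contraNneq ncd => r00; apply/congP; exists q; lia.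
lia.
Qed.

Section TranslationInvariantOrder.
Variable p : TTot n.

Lemma TTot_shiftM (k a b : int) : p (a + k * n%:Z) (b + k * n%:Z) = p a b.
Proof.
have h (m : nat) x y : p (x + m%:Z * n%:Z) (y + m%:Z * n%:Z) = p x y.
  elim: m => [|m IH]; first by rewrite !mul0r !addr0.
  by rewrite -IH -[RHS]TTot_shift; congr (p _ _); lia.
have [->|->] : k = `|k|%N%:Z \/ k = - `|k|%N%:Z by lia.
  exact: h.
by rewrite -(h `|k|%N); congr (p _ _); lia.
Qed.

(** A class waxes when [a] precedes [a + n] and wanes otherwise; translating this one comparison
    orders the whole class. *)
Lemma TTot_wax (k a : int) : p a (a + n%:Z) -> 0 < k -> p a (a + k * n%:Z).
Proof.
move=> h k0; have -> : k = (absz k).-1.+1%:Z by lia.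
elim: (absz k).-1 => [|m IH]; first by rewrite mul1r.
apply: Tot_trans IH _; rewrite -(TTot_shiftM m.+1%:Z) in h.
by congr (is_true (p _ _)): h; lia.
Qed.

Lemma TTot_wane (k a : int) : p (a + n%:Z) a -> 0 < k -> p (a + k * n%:Z) a.
Proof.
move=> h k0; have -> : k = (absz k).-1.+1%:Z by lia.
elim: (absz k).-1 => [|m IH]; first by rewrite mul1r.
apply: Tot_trans IH; rewrite -(TTot_shiftM m.+1%:Z) in h.
by congr (is_true (p _ _)): h; lia.
Qed.

Lemma TTot_waxwane (a : int) : p a (a + n%:Z) \/ p (a + n%:Z) a.
Proof.
have [|/negP h] := boolP (p a (a + n%:Z)); [by left|right].
by apply: Tot_flip h; lia.
Qed.

Lemma TTot_waxI (k a : int) : p a (a + k * n%:Z) -> 0 < k -> p a (a + n%:Z).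
Proof.
move=> h k0; have [//|w] := TTot_waxwane a.
by case: (Tot_asym h (TTot_wane w k0)).
Qed.

Lemma TTot_waneI (k a : int) : p (a + k * n%:Z) a -> 0 < k -> p (a + n%:Z) a.
Proof.
move=> h k0; have [w|//] := TTot_waxwane a.
by case: (Tot_asym h (TTot_wax w k0)).
Qed.

Lemma TTot_shiftP (k a b a' b' : int) :
  a' = a + k * n%:Z -> b' = b + k * n%:Z -> p a b -> p a' b'.
Proof. by move=> -> ->; rewrite TTot_shiftM. Qed.

Lemma TTot_shift2 (k l a b : int) :
  p (a + k * n%:Z) (b + l * n%:Z) = p a (b + (l - k) * n%:Z).
Proof. by rewrite -[RHS](TTot_shiftM k) -addrA -mulrDl subrK. Qed.

Lemma TTot_step (k l a : int) :
  p a (a + k * n%:Z) -> 0 < k * l -> p a (a + l * n%:Z).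
Proof.
move=> h kl; have [k0|k0|k0] := ltgtP k 0; last by rewrite k0 mul0r ltxx in kl.
  have l0 : l < 0 by nia.
  have w : p (a + n%:Z) a.
    apply: (@TTot_waneI (- k)); last lia.
    by apply: (TTot_shiftP (k := - k)) h; lia.
  apply: (TTot_shiftP (k := l)) (TTot_wane w (k := - l) _); lia.
have l0 : 0 < l by nia.
exact: TTot_wax (TTot_waxI h k0) l0.
Qed.

(** If the class of [b] waxes, its member at [l] comes after the one at [k]; if it wanes, after the
    one at [m]. *)
Lemma TTot_convex (k l m a b : int) : k <= l -> l <= m ->
  p a (b + k * n%:Z) -> p a (b + m * n%:Z) -> p a (b + l * n%:Z).
Proof.
move=> kl lm ak am.
have [->//|nkl] := eqVneq l k; have [->//|nlm] := eqVneq l m.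
have [w|w] := TTot_waxwane b.
  apply: Tot_trans ak _.
  apply: (TTot_shiftP (k := k)) (TTot_wax w (k := l - k) _); lia.
apply: Tot_trans am _.
apply: (TTot_shiftP (k := l)) (TTot_wane w (k := m - l) _); lia.
Qed.

End TranslationInvariantOrder.

(** * Replacing chains of inversions by chains with incongruent steps *)

Section RealPaths.
Variable B : set (TTot n).

Let S (a b : int) : Prop := exists2 p : TTot n, B p & inv p a b.
Let S_real (a b : int) : Prop := S a b /\ ~~ cong a b.
Let G := clos_trans _ S_real.

Let G_real a b : S a b -> ~~ cong a b -> G a b.
Proof. by move=> *; apply: t_step. Qed.

(* The congruent step from [c] to [c + n] followed by a step to [d] is replaced
   by a step to [d], or by a chain through the representative of [d] modulo [n]
   lying between [c] and [c + n]. *)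
Lemma real_path_wane_first (p : TTot n) c d : B p -> p (c + n%:Z) c ->
  S_real (c + n%:Z) d -> G c d.
Proof.
move=> Bp wp [[q Bq [/= cd qd]] ncd'].
have ncd : ~~ cong c d by rewrite -(cong_shiftl 1) mul1r.
have cd0 : c < d by lia.
have neq x y : ~~ cong x y -> x != y by apply: contraNneq => ->; exact: cong_refl.
have [pdc|npdc] := boolP (p d c); first by apply: G_real ncd; exists p.
have pcd : p c d by apply: Tot_flip; [rewrite eq_sym; exact: neq|exact/negP].
have [wq|wq] := TTot_waxwane q c; last first.
  by apply: G_real ncd; exists q => //; split=> //; exact: Tot_trans wq.
(* The detour is c < d - m n < c + n < d: [q], which waxes on the class of [c], inverts the outer
   two steps, and [p], which wanes there, inverts the middle one. *)
have [m [cm mc]] := cong_representative ncd.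
have m0 : 0 < m by nia.
have mn : 0 < m * n%:Z by nia.
have ncm : ~~ cong c (d - m * n%:Z) by rewrite -mulNr cong_shiftr.
have cd1 : G c (d - m * n%:Z).
  apply: G_real ncm; exists q => //; split=> //=.
  have [m1|m1] := eqVneq m 1.
    by apply: (TTot_shiftP (k := - m)) qd; lia.
  have wq' : q (c + n%:Z) (c + m * n%:Z).
    apply: (TTot_shiftP (k := 1)) (TTot_wax (k := m - 1) wq _); lia.
  by apply: (TTot_shiftP (k := - m)) (Tot_trans qd wq'); lia.
have cd2 : G (d - m * n%:Z) (c + n%:Z).
  apply: G_real.
    exists p => //; split=> //=; apply: (Tot_trans wp).
    by apply: (TTot_shiftP (k := - m)) (Tot_trans (TTot_wane wp m0) pcd); lia.
  by rewrite -mulNr cong_shiftl -[n%:Z]mul1r cong_shiftr cong_sym.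
apply: t_trans cd1 (t_trans _ _ _ _ _ cd2 _); apply: G_real ncd'.
by exists q.
Qed.

(** Mirror image of [real_path_wane_first]; the detour here is b, c, b + m n, c + n. *)
Lemma real_path_wane_last (p : TTot n) b c : B p -> p (c + n%:Z) c ->
  S_real b c -> G b (c + n%:Z).
Proof.
move=> Bp wp [[q Bq [/= bc qc]] nbc].
have nbc' : ~~ cong b (c + n%:Z) by rewrite -[n%:Z]mul1r cong_shiftr.
have bc0 : b < c + n%:Z by lia.
have neq x y : ~~ cong x y -> x != y by apply: contraNneq => ->; exact: cong_refl.
have [pcb|npcb] := boolP (p (c + n%:Z) b); first by apply: G_real nbc'; exists p.
have pbc : p b (c + n%:Z).
  by apply: Tot_flip; [rewrite eq_sym; exact: neq|exact/negP].
have [wq|wq] := TTot_waxwane q c; last first.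
  by apply: G_real nbc'; exists q => //; split=> //; exact: Tot_trans qc.
have ncb : ~~ cong c b by rewrite cong_sym.
have [m' [cm mc]] := cong_representative ncb.
pose m := - m'; have em : m' = - m by rewrite opprK.
rewrite em in cm mc.
have m0 : 0 < m by nia.
have mn : 0 < m * n%:Z by nia.
have ncm : ~~ cong c (b + m * n%:Z) by rewrite cong_shiftr.
have cd2 : G c (b + m * n%:Z).
  apply: G_real ncm; exists p => //; split=> /=; first lia.
  apply: Tot_trans (TTot_wane wp m0).
  by apply: (TTot_shiftP (k := m)) (Tot_trans pbc wp); lia.
have cd1 : G (b + m * n%:Z) (c + n%:Z).
  apply: G_real; last by rewrite cong_shiftl.
  exists q => //; split=> /=; first lia.
  have qc' : q (c + m * n%:Z) (b + m * n%:Z) by rewrite TTot_shiftM.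
  have [m1|m1] := eqVneq m 1; first by rewrite m1 !mul1r in qc' *.
  apply: Tot_trans qc'.
  apply: (TTot_shiftP (k := 1)) (TTot_wax (k := m - 1) wq _); lia.
apply: t_trans (t_trans _ _ _ _ _ cd2 cd1); apply: G_real nbc.
by exists q.
Qed.

Lemma clos_trans_real a b :
  clos_trans _ S a b -> ~~ cong a b -> G a b.
Proof.
have wane_shift (p : TTot n) c (k : int) :
    p (c + n%:Z) c -> p (c + k * n%:Z + n%:Z) (c + k * n%:Z).
  by apply: (TTot_shiftP (k := k)); lia.
have first (p : TTot n) c d (k : nat) : B p -> p (c + n%:Z) c ->
    G (c + k%:Z * n%:Z) d -> G c d.
  move=> Bp w; elim: k => [|k IH]; first by rewrite mul0r addr0.
  have w' := wane_shift _ _ k%:Z w.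
  rewrite (_ : c + _ = c + k%:Z * n%:Z + n%:Z); last lia.
  move=> h; apply: IH; have [h'|[e h' ed]] := clos_trans_first h.
    exact: real_path_wane_first w' h'.
  exact: t_trans (real_path_wane_first Bp w' h') ed.
have last (p : TTot n) c d (k : nat) : B p -> p (c + n%:Z) c ->
    G d c -> G d (c + k%:Z * n%:Z).
  move=> Bp w dc; elim: k => [|k IH]; first by rewrite mul0r addr0.
  have w' := wane_shift _ _ k%:Z w.
  rewrite (_ : c + _ = c + k%:Z * n%:Z + n%:Z); last lia.
  have [h'|[e ed h']] := clos_trans_last IH.
    exact: real_path_wane_last w' h'.
  exact: t_trans ed (real_path_wane_last Bp w' h').
have S_lt x y : S x y -> x < y by move=> [? _ /inv_lt].
have cong_lt x y : x < y -> cong x y ->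
    exists2 k : nat, y = x + k%:Z * n%:Z & (0 < k)%N.
  by move=> xy /congP[k ek]; exists (absz k); nia.
(* Induction invariant: a chain has a real replacement, or it joins congruent ends of a class on
   which some order of [B] wanes. In the second case its length is absorbed, [n] at a time, by the
   neighbouring real chain. *)
suff h : clos_trans _ S a b ->
    G a b \/ cong a b /\ exists2 p : TTot n, B p & p (a + n%:Z) a.
  by move=> /h[//|[-> ]].
elim=> {a b} [a b Sab|a c b Sac IH1 Scb IH2].
  have [ab|nab] := boolP (cong a b); [right; split=> //|by left; exact: G_real].
  have [k bk k0] := cong_lt _ _ (S_lt _ _ Sab) ab.
  by case: Sab => p Bp [/= _ pba]; exists p => //; rewrite bk in pba;
    exact: TTot_waneI pba _.
case: IH2 => [Gcb|[cb [q Bq wq]]]; case: IH1 => [Gac|[ac [p Bp wp]]].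
- by left; exact: t_trans Gcb.
- left; have [k ck _] := cong_lt _ _ (clos_trans_lt S_lt Sac) ac.
  by apply: (first p _ _ k) => //; rewrite -ck.
- left; have [k bk _] := cong_lt _ _ (clos_trans_lt S_lt Scb) cb.
  by rewrite bk; apply: (last q).
- by right; split; [exact: cong_trans cb|exists p].
Qed.

End RealPaths.
End Residues.

(** * Coordinates of affine roots *)

Section Roots.
Variables (R : realType) (n : nat) (n_gt0 : (0 < n)%N).
Local Notation alpha := (alpha R n).
Local Notation etilde := (etilde R n).

(** A column is used as a linear functional, to turn relations between roots into relations between
    reals. *)
Definition coord (C : 'cV[R]_(n + 1)) (u : 'rV[R]_(n + 1)) : R := (u *m C) 0 0.

Lemma coordD C u v : coord C (u + v) = coord C u + coord C v.
Proof. by rewrite /coord mulmxDl mxE. Qed.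

Lemma coordN C u : coord C (- u) = - coord C u.
Proof. by rewrite /coord mulNmx mxE. Qed.

Lemma coordZ C s u : coord C (s *: u) = s * coord C u.
Proof. by rewrite /coord -scalemxAl mxE. Qed.

Lemma coord_alpha C a b :
  coord C (alpha a b) = coord C (etilde b) - coord C (etilde a).
Proof. by rewrite /alpha coordD coordN. Qed.

Lemma coord_delta_mx C j : coord C (delta_mx 0 j) = C j 0.
Proof. by rewrite /coord -rowE mxE. Qed.

Lemma coord_etilde C a : exists i : 'I_n, exists k : int,
  a = i%:Z + 1 + k * n%:Z /\
  coord C (etilde a) = C (lshift 1 i) 0 + k%:~R * C (rshift n 0) 0.
Proof.
have n0 : n%:Z != 0 by rewrite eqz_nat -lt0n.
have r0 := modz_ge0 (a - 1) n0; have rn := ltz_mod (a - 1) n0.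
have e := divz_eq (a - 1) n%:Z.
set q := ((a - 1) %/ n%:Z)%Z in e; set r := ((a - 1) %% n%:Z)%Z in e r0 rn.
have rn' : (absz r < n)%N by lia.
exists (Ordinal rn'), q.
have ea : a = (Ordinal rn')%:Z + 1 + q * n%:Z by rewrite /=; lia.
split=> //; rewrite {1}ea etilde_shift// etilde_basis coordD coordZ.
by rewrite /delta !coord_delta_mx.
Qed.

(** Chosen so that the functional takes [etilde a] to [a]: the value on [delta] has to be [n]. *)
Definition height_col : 'cV[R]_(n + 1) :=
  col_mx (\col_(i < n) (i%:R + 1)) (const_mx n%:R).

Definition residue_col (r : int) : 'cV[R]_(n + 1) :=
  col_mx (\col_(i < n) (cong n r (i%:Z + 1))%:R) 0.

Lemma height_etilde a : coord height_col (etilde a) = a%:~R.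
Proof.
have [i [k [-> ->]]] := coord_etilde height_col a.
by rewrite col_mxEu col_mxEd !mxE !intrD intrM.
Qed.

Lemma residue_etilde r a :
  coord (residue_col r) (etilde a) = (cong n r a)%:R.
Proof.
have [i [k [-> ->]]] := coord_etilde (residue_col r) a.
by rewrite col_mxEu col_mxEd !mxE mulr0 addr0 cong_shiftr.
Qed.

Lemma alphaN a b : alpha b a = - alpha a b.
Proof. by rewrite /alpha opprB. Qed.

Lemma alphaD a b c : alpha a c = alpha a b + alpha b c.
Proof. by rewrite /alpha [RHS]addrC subrKA. Qed.

Lemma alpha_shift (k a b : int) : alpha (a + k * n%:Z) (b + k * n%:Z) = alpha a b.
Proof. by rewrite /alpha !etilde_shift// opprD addrACA subrr addr0. Qed.

Lemma alpha_shiftr (k a b : int) :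
  alpha a (b + k * n%:Z) = alpha a b + k%:~R *: delta R n.
Proof. by rewrite /alpha etilde_shift// addrAC. Qed.

(* The coefficient in [etilde a] of the basis vector of the class of [r]. *)
Definition res (r a : int) : R := if cong n r a then 1 else 0.

Lemma alpha_coords a b c d e f s t :
  alpha e f = s *: alpha a b + t *: alpha c d ->
  (f%:~R - e%:~R = s * (b%:~R - a%:~R) + t * (d%:~R - c%:~R) :> R) /\
  forall r, res r f - res r e = s * (res r b - res r a) + t * (res r d - res r c).
Proof.
move=> E.
have F C : coord C (alpha e f) =
    s * coord C (alpha a b) + t * coord C (alpha c d).
  by rewrite E coordD !coordZ.
split=> [|r].
  by have := F height_col; rewrite !coord_alpha !height_etilde.
have resE x : res r x = coord (residue_col r) (etilde x).
  by rewrite residue_etilde /res; case: ifP.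
by rewrite !resE -!coord_alpha F.
Qed.

(** The residue functionals match the classes and force [s = 1], the sign of [s] excluding the
    opposite root; the height then equates the two shifts. *)
Lemma alpha_inj a b e f s : ~~ cong n a b -> ~~ cong n e f -> 0 <= s ->
  alpha e f = s *: alpha a b ->
  exists k : int, e = a + k * n%:Z /\ f = b + k * n%:Z.
Proof.
move=> nab nef s0 E.
have [|H C] := @alpha_coords a b a b e f s 0; first by rewrite scale0r addr0.
have nfe : ~~ cong n f e by rewrite cong_sym.
have Cf := C f; rewrite /res cong_refl (negbTE nfe) in Cf.
have fb : cong n f b.
  by apply: contraT => /negbTE nfb; move: Cf; rewrite nfb; case: ifP => _; lra.
have fa : cong n f a = false.
  by apply: contraNF nab => fa; apply: cong_trans fb; rewrite cong_sym.
have s1 : s = 1 by move: Cf; rewrite fb fa; lra.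
have Ce := C e; rewrite /res cong_refl (negbTE nef) in Ce.
have ea : cong n e a.
  by apply: contraT => /negbTE nea; move: Ce; rewrite nea; case: ifP => _; lra.
move: fb ea; rewrite cong_sym => /congP[k fk]; rewrite cong_sym => /congP[l el].
have : f%:~R - e%:~R = (b%:~R - a%:~R) :> R by rewrite H s1; lra.
rewrite -!intrB => /intr_inj fe.
by exists l; split=> //; lia.
Qed.

Lemma cong_eqr x y : cong n x y -> forall z, cong n z x = cong n z y.
Proof.
move=> xy z; apply/idP/idP => h; first exact: cong_trans xy.
by apply: cong_trans h _; rewrite cong_sym.
Qed.

(** Residue coordinates leave two cases: (c, d) has the classes of (a, b) in the same order or in
    the opposite order. The first is settled by convexity of shifts, the second by monotonicity of
    the class of [b]. *)
Lemma alpha_cone_ord_parallel (p : TTot n) a b c d e f s t :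
  ~~ cong n a b -> ~~ cong n c d -> 0 < s -> 0 < t ->
  cong n e a -> cong n f b ->
  alpha e f = s *: alpha a b + t *: alpha c d -> p a b -> p c d -> p e f.
Proof.
move=> nab ncd s0 t0 ea fb E pab pcd; have [H C] := alpha_coords E.
have nR : 0 < n%:~R :> R by rewrite ltr0z.
have Ee := cong_eqr ea; have Ef := cong_eqr fb.
have nba : ~~ cong n b a by rewrite cong_sym.
have ndc : ~~ cong n d c by rewrite cong_sym.
have Cb := C b; rewrite /res Ef Ee cong_refl (negbTE nba) in Cb.
have Ca := C a; rewrite /res Ef Ee cong_refl (negbTE nab) in Ca.
have Cd := C d; rewrite /res Ef Ee cong_refl (negbTE ndc) in Cd.
have /congP[l el] : cong n a e by rewrite cong_sym.
have /congP[l' fl] : cong n b f by rewrite cong_sym.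
rewrite el fl (TTot_shift2 n_gt0).
have [bd|nbd] := boolP (cong n b d).
  rewrite cong_sym in bd; have Ed := cong_eqr bd.
  have ac : cong n a c.
    apply: contraT => /negbTE nac; move: Ca Cb.
    rewrite nac !Ed (negbTE nab) cong_refl.
    have -> : cong n b c = false.
      by apply/negbTE; rewrite cong_sym -Ed.
    by nra.
  have /congP[k ck] := ac; have /congP[k' dk] : cong n b d by rewrite cong_sym.
  have st : s + t = 1.
    move: Cb; rewrite !Ed cong_refl.
    have -> : cong n b c = false by apply/negbTE; rewrite cong_sym -Ed.
    by lra.
  (* As [s + t = 1], the shift of (e, f) lies between 0 and that of (c, d). *)
  have M : (l' - l)%:~R = t * (k' - k)%:~R :> R.
    move: H; rewrite el fl ck dk !intrD !intrM !intrN => H.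
    have {}st : s = 1 - t by lra.
    rewrite st in H; apply: (mulIf (lt0r_neq0 nR)).
    have := H; nra.
  have pak : p a (b + (k' - k) * n%:Z) by rewrite -(TTot_shift2 n_gt0) -ck -dk.
  have pa0 : p a (b + 0 * n%:Z) by rewrite mul0r addr0.
  have t1 : t < 1 by lra.
  have [K0|K0] := lerP 0 (k' - k).
    apply: (TTot_convex n_gt0 _ _ pa0 pak); rewrite -(ler_int R) M.
      by rewrite mulr_ge0 ?ler0z// ltW.
    by rewrite ler_piMl ?ler0z// ltW.
  apply: (TTot_convex n_gt0 _ _ pak pa0); rewrite -(ler_int R) M.
    by rewrite ler_niMl ?lerz0 ?ltW.
  by rewrite mulr_ge0_le0 ?lerz0 ?ltW.
have [bc|nbc] := boolP (cong n b c).
  have cb : cong n c b by rewrite cong_sym.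
  have Ec := cong_eqr cb.
  have ad : cong n a d.
    apply: contraT => /negbTE nad; move: Ca Cb.
    rewrite nad !Ec (negbTE nab) cong_refl (negbTE nbd).
    by nra.
  have /congP[k ck] := bc; have /congP[k' dk] := ad.
  have st : s = 1 + t by move: Cb; rewrite bc (negbTE nbd); lra.
  have M : (l' - l)%:~R = t * (k' - k)%:~R :> R.
    move: H; rewrite el fl ck dk !intrD !intrM !intrN => H.
    rewrite st in H; apply: (mulIf (lt0r_neq0 nR)).
    have := H; nra.
  have pbk : p b (a + (k' - k) * n%:Z) by rewrite -(TTot_shift2 n_gt0) -ck -dk.
  (* The two comparisons compose to one inside the class of [b], and the required shift [l' - l] has
     the same sign as [k' - k]. *)
  have pbb : p b (b + (k' - k) * n%:Z).
    by apply: Tot_trans pbk _; rewrite (TTot_shiftM n_gt0).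
  apply: (Tot_trans pab); apply: (TTot_step n_gt0 pbb).
  rewrite -(ltr0z R) intrM M mulrCA mulr_gt0// -expr2 exprn_even_gt0//=.
  by rewrite intr_eq0; apply: contraTneq pbb => ->; rewrite mul0r addr0 Tot_irr.
move: Cb Cd; rewrite (negbTE nbd) (negbTE nbc) [cong n d b]cong_sym (negbTE nbd).
by case: ifP => _; nra.
Qed.

(** For positive coefficients the residues put [f] in the class of [b] or [d] and [e] in that of [a]
    or [c]. If both come from one root, the parallel case applies; otherwise [s = t = 1], the roots
    compose after a translation, and transitivity applies. *)
Lemma alpha_cone_ord (p : TTot n) a b c d e f s t :
  ~~ cong n a b -> ~~ cong n c d -> ~~ cong n e f -> 0 <= s -> 0 <= t ->
  alpha e f = s *: alpha a b + t *: alpha c d -> p a b -> p c d -> p e f.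
Proof.
move=> nab ncd nef.
have nfe : ~~ cong n f e by rewrite cong_sym.
rewrite le_eqVlt => /predU1P[<-|s0].
  rewrite scale0r add0r => t0 /(alpha_inj ncd nef t0)[k [-> ->]] _.
  by rewrite (TTot_shiftM n_gt0).
rewrite le_eqVlt => /predU1P[<-|t0].
  rewrite scale0r addr0 => /(alpha_inj nab nef (ltW s0))[k [-> ->]] + _.
  by rewrite (TTot_shiftM n_gt0).
wlog fb : a b c d s t nab ncd s0 t0 / cong n f b.
  move=> wl E pab pcd.
  have [fb|nfb] := boolP (cong n f b); first exact: (wl a b c d s t).
  have [fd|nfd] := boolP (cong n f d).
    by apply: (wl c d a b t s) => //; rewrite E addrC.
  have [_ /(_ f)] := alpha_coords E.
  rewrite /res cong_refl (negbTE nfe) (negbTE nfb) (negbTE nfd).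
  by case: ifP => _; case: ifP => _; nra.
move=> E pab pcd.
have [ea|nea] := boolP (cong n e a).
  exact: (alpha_cone_ord_parallel nab ncd s0 t0 ea fb E).
have [H C] := alpha_coords E.
have ec : cong n e c.
  apply: contraT => nec; move: (C e).
  rewrite /res cong_refl (negbTE nef) (negbTE nea) (negbTE nec).
  by case: ifP => _; case: ifP => _; nra.
have [fd|nfd] := boolP (cong n f d).
  by apply: (alpha_cone_ord_parallel ncd nab t0 s0 ec fd) => //; rewrite E addrC.
have Ec := cong_eqr ec; have Ef := cong_eqr fb.
have nbd : ~~ cong n b d by rewrite cong_sym -Ef cong_sym.
have nbc : ~~ cong n b c by rewrite -Ec cong_sym -Ef.
have nac : ~~ cong n a c by rewrite -Ec cong_sym.
have nca : ~~ cong n c a by rewrite cong_sym.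
have nba : ~~ cong n b a by rewrite cong_sym.
have ncb : ~~ cong n c b by rewrite cong_sym.
have ndb : ~~ cong n d b by rewrite cong_sym.
have ndc : ~~ cong n d c by rewrite cong_sym.
have := C b; have := C c; have := C d.
rewrite /res !Ef !Ec !cong_refl (negbTE nbc) (negbTE nbd) (negbTE ncd).
rewrite (negbTE nba) (negbTE nca) (negbTE ncb) (negbTE ndb) (negbTE ndc).
case: ifP => [da|_] Cd Cc Cb; last by nra.
have t1 : t = 1 by lra.
have s1 : s = 1 by lra.
rewrite s1 t1 !mul1r -!intrB -intrD in H; move: H => /intr_inj H.
have /congP[k dk] : cong n a d by rewrite cong_sym.
have /congP[l el] : cong n c e by rewrite cong_sym.
have /congP[l' fl] : cong n b f by rewrite cong_sym.
have kE : (l' - l) * n%:Z = k * n%:Z.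
  by clear - H dk el fl; lia.
rewrite el fl (TTot_shift2 n_gt0) kE; apply: Tot_trans pcd _.
by rewrite dk (TTot_shiftM n_gt0).
Qed.

End Roots.

(** * Biclosed sets of affine roots *)

(** The left adjoint [sigma] preserves joins, so the hypotheses lift to [L]. Having adjoints on both
    sides, [pi] preserves meets and joins and brings the conclusion back. *)
Lemma join_semidistributive_retract (dL dM : Order.disp_t) (L : porderType dL)
    (M : porderType dM) (pi : L -> M) (sigma tau : M -> L) :
  (forall x p, (sigma x <= p)%O <-> (x <= pi p)%O) ->
  (forall x p, (pi p <= x)%O <-> (p <= tau x)%O) ->
  cancel sigma pi -> is_complete_lattice L ->
  join_semidistributive L -> join_semidistributive M.
Proof.
move=> sigmaP tauP sigmaK cL jL y z X X0 hX m hm.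
have pi_le p q : (p <= q)%O -> (pi p <= pi q)%O.
  by move=> pq; apply/tauP/(le_trans pq)/tauP.
have [_ [m' [m'_lb m'_glb]]] := cL (sigma @` X).
have hm' : infimums X (pi m').
  split=> [x Xx|w w_lb]; first by rewrite -[x]sigmaK; apply/pi_le/m'_lb/imageP.
  apply/sigmaP/m'_glb => _ [x Xx <-]; apply/sigmaP; rewrite sigmaK.
  exact: w_lb.
rewrite (is_subset1_infimums hm hm').
have h' x : X x -> supremums [set sigma x; sigma y] (sigma z).
  move=> /hX[z_ub z_lub]; split=> [_ [->|->]|p p_ub].
  - by apply/sigmaP; rewrite sigmaK; apply: z_ub; left.
  - by apply/sigmaP; rewrite sigmaK; apply: z_ub; right.
  apply/sigmaP/z_lub => _ [->|->]; apply/sigmaP/p_ub; by [left|right].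
have [sz_ub sz_lub] : supremums [set m'; sigma y] (sigma z).
  apply: (jL _ _ (sigma @` X)); first exact: image_nonempty.
    by move=> _ [x Xx <-]; exact: h'.
  by split.
split=> [_ [->|->]|w w_ub]; rewrite -[z]sigmaK.
- by apply/pi_le/sz_ub; left.
- by rewrite -[y]sigmaK; apply/pi_le/sz_ub; right.
apply/tauP/sz_lub => _ [->|->]; apply/tauP; rewrite ?sigmaK; apply: w_ub.
  by left.
by right.
Qed.

Section DyerPoset.
Variables (R : realType) (n : nat) (n_gt0 : (0 < n)%N).
Local Notation alpha := (alpha R n).
Local Notation cong := (cong n).
Local Notation D := (Dyer R n).
Local Notation Phi := (@positive_roots R n).
Implicit Types (X Y : D) (a b c d e f k : int).

Lemma Dyer_biclosed X : biclosed (Dyer_set X).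
Proof. exact: asboolW (Dyer_setP X). Qed.

Lemma positive_alpha a b : a < b -> ~~ cong a b -> Phi (alpha a b).
Proof. by exists a, b. Qed.

Definition dinv X a b : Prop := [/\ a < b, ~~ cong a b & Dyer_set X (alpha a b)].

Lemma le_dinv X Y : (X <= Y)%O <-> (forall a b, dinv X a b -> dinv Y a b).
Proof.
rewrite Dyer_leE; split=> [h a b [ab nab /h]//|h v Xv].
have [sub _ _] := Dyer_biclosed X; have [a [b [ab nab ev]]] := sub _ Xv.
by subst v; have [] := h a b (And3 ab nab Xv).
Qed.

Lemma dinv_eq X Y : (forall a b, dinv X a b <-> dinv Y a b) -> X = Y.
Proof. by move=> h; apply/le_anti/andP; split; apply/le_dinv => a b /h. Qed.

Lemma Dyer_compl_subproof X : `[< biclosed (Phi `\` Dyer_set X) >].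
Proof.
have [sub cl ccl] := Dyer_biclosed X.
by apply/asboolP; split=> //; rewrite setDD setIidr.
Qed.

Definition Dyer_compl X : D := MkDyer (Dyer_compl_subproof X).

Lemma dinv_compl X a b :
  dinv (Dyer_compl X) a b <-> [/\ a < b, ~~ cong a b & ~ dinv X a b].
Proof.
split=> [[ab nab /= [_ n1]]|[ab nab n1]]; split=> //; first by case.
by split; [exact: positive_alpha|move=> Xab; apply: n1].
Qed.

(** * From TITOs to biclosed sets *)

Definition real_inversions (p : TTot n) : set 'rV[R]_(n + 1) :=
  [set v | exists a b, [/\ inv p a b, ~~ cong a b & v = alpha a b]].

Lemma real_inversionsP (p : TTot n) a b : ~~ cong a b ->
  real_inversions p (alpha a b) <-> inv p a b.
Proof.
move=> nab; split=> [[c [d [[/= cd pdc] ncd E]]]|pab]; last by exists a, b.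
rewrite -[X in _ = X]scale1r in E.
have [k [-> ->]] := alpha_inj n_gt0 ncd nab ler01 E.
by split; rewrite /= ?ltrD2r// (TTot_shiftM n_gt0).
Qed.

(** Closedness is [alpha_cone_ord] for the converse order, and closedness of the complement is the
    same lemma for [p] itself. *)
Lemma real_inversions_biclosed (p : TTot n) : `[< biclosed (real_inversions p) >].
Proof.
apply/asboolP; split=> [v [a [b [[/= ab _] nab ->]]]|u v w|u v w].
- exact: positive_alpha.
- move=> [a [b [[/= ab pba] nab ->]]] [c [d [[/= cd pdc] ncd ->]]].
  move=> [e [f [ef nef ->]]] [s [t [s0 t0 E]]].
  exists e, f; split=> //; split=> //=.
  exact: (alpha_cone_ord n_gt0 (p := TTot_converse p) nab ncd nef s0 t0 E).
move=> [[a [b [ab nab ->]]] pab] [[c [d [cd ncd ->]]] pcd].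
move=> w_pos; case: (w_pos) => [e [f [ef nef we]]] [s [t [s0 t0 E]]].
split=> //; rewrite we => /(real_inversionsP _ nef)[_ /= pfe].
have ord x y : x < y -> ~~ cong x y -> ~ real_inversions p (alpha x y) -> p x y.
  move=> xy nxy h; apply: Tot_flip; first by rewrite gt_eqF.
  by move=> pyx; apply/h/real_inversionsP.
rewrite we in E; apply: Tot_asym pfe _.
by apply: (alpha_cone_ord n_gt0 nab ncd nef s0 t0 E); apply: ord.
Qed.

Definition Dyer_of_TTot (p : TTot n) : D := MkDyer (real_inversions_biclosed p).

Lemma dinv_Dyer_of_TTot p a b :
  dinv (Dyer_of_TTot p) a b <-> inv p a b /\ ~~ cong a b.
Proof.
split=> [[ab nab /(real_inversionsP _ nab)]|[pab nab]] //.
by split=> //; [exact: inv_lt pab|apply/real_inversionsP].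
Qed.

Lemma Dyer_of_TTot_converse p :
  Dyer_of_TTot (TTot_converse p) = Dyer_compl (Dyer_of_TTot p).
Proof.
apply: dinv_eq => a b; split.
  move=> /dinv_Dyer_of_TTot[/(inv_converse p)[ab _ n1] nab]; apply/dinv_compl.
  by split=> // /dinv_Dyer_of_TTot[].
move=> /dinv_compl[ab nab n1]; apply/dinv_Dyer_of_TTot; split=> //.
by apply/(inv_converse p); split=> // pab; apply/n1/dinv_Dyer_of_TTot.
Qed.

(* The order on incongruent integers that a TITO with real inversion set [X]
   has to satisfy. *)
Definition dlt X a b : Prop :=
  (a < b /\ ~ Dyer_set X (alpha a b)) \/ (b < a /\ Dyer_set X (alpha b a)).

Lemma dlt_flip X a b : ~~ cong a b -> ~ dlt X a b -> dlt X b a.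
Proof.
move=> nab h; have [ab|ba|eab] := ltgtP a b.
- by right; split=> //; apply: contrapT => h'; apply: h; left.
- by left; split=> // h'; apply: h; right.
- by rewrite eab cong_refl in nab.
Qed.

Lemma dlt_asym X a b : dlt X a b -> dlt X b a -> False.
Proof.
by move=> [[ab h]|[ba h]] [[ba' h']|[ab' h']]//; lia.
Qed.

Lemma dltNC X a b : ~~ cong a b -> dlt X b a <-> ~ dlt X a b.
Proof. by move=> nab; split; [move=> h /dlt_asym; apply|exact: dlt_flip]. Qed.

Lemma dlt_shift k X a b : dlt X (a + k * n%:Z) (b + k * n%:Z) <-> dlt X a b.
Proof. by rewrite /dlt !ltrD2r !alpha_shift. Qed.

Lemma dlt_compl X a b : ~~ cong a b -> dlt (Dyer_compl X) a b <-> dlt X b a.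
Proof.
move=> nab; rewrite /dlt /=; split=> -[[ab h]|[ab h]].
- right; split=> //; apply: contrapT => h'; apply: h.
  by split=> //; exact: positive_alpha.
- by left; split=> //; case: h.
- by right; split=> //; split=> //; apply: positive_alpha; rewrite // cong_sym.
- by left; split=> // -[].
Qed.

(** When both pairs have the same sign, biclosedness applies directly. When the signs differ, a
    wrong answer for (e, f) lets the relation be solved for one of the given roots, as a positive
    combination that puts it on the wrong side of [X]. *)
Lemma dlt_cone X a b c d e f (s t : R) :
  ~~ cong a b -> ~~ cong c d -> ~~ cong e f -> 0 < s -> 0 < t ->
  alpha e f = s *: alpha a b + t *: alpha c d ->
  dlt X a b -> dlt X c d -> dlt X e f.
Proof.
move=> nab ncd nef s0 t0 E.
have [sub cl ccl] := Dyer_biclosed X.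
have nfe : ~~ cong f e by rewrite cong_sym.
have s_neq0 := lt0r_neq0 s0; have t_neq0 := lt0r_neq0 t0.
have mixed a' b' c' d' s' t' : ~~ cong a' b' -> ~~ cong c' d' -> 0 < s' -> 0 < t' ->
    alpha e f = s' *: alpha a' b' + t' *: alpha c' d' ->
    a' < b' -> ~ Dyer_set X (alpha a' b') ->
    d' < c' -> Dyer_set X (alpha d' c') -> dlt X e f.
  move=> {}nab {}ncd {}s0 {}t0 {}E ab nX dc Xdc.
  have {}s_neq0 := lt0r_neq0 s0; have {}t_neq0 := lt0r_neq0 t0.
  have [ef|fe|eef] := ltgtP e f; last by rewrite eef cong_refl in nef.
    left; split=> // Xef; apply: nX.
    apply: (cl _ _ _ Xef Xdc); first exact: positive_alpha.
    exists s'^-1, (s'^-1 * t'); rewrite invr_ge0 mulr_ge0 ?invr_ge0 ?ltW//.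
    split=> //; rewrite E [alpha d' c']alphaN.
    move: (alpha a' b') (alpha c' d') => A C; rewrite scalerDr !scalerA mulVf//.
    by rewrite scale1r scalerN addrK.
  right; split=> //; apply: contrapT => nXfe.
  have ncd' : ~~ cong d' c' by rewrite cong_sym.
  suff [_ h] : (Phi `\` Dyer_set X) (alpha d' c') by apply: h.
  apply: (ccl (alpha f e) (alpha a' b')).
  - by split=> //; exact: positive_alpha.
  - by split=> //; exact: positive_alpha.
  - exact: positive_alpha.
  exists t'^-1, (t'^-1 * s'); rewrite invr_ge0 mulr_ge0 ?invr_ge0 ?ltW//.
  split=> //; rewrite [alpha f e]alphaN E [alpha d' c']alphaN.
  move: (alpha a' b') (alpha c' d') => A C; rewrite opprD scalerDr.
  by rewrite !scalerN !scalerA mulVf// scale1r addrAC addNr add0r.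
have [H _] := alpha_coords n_gt0 E.
have ltR x y : (x < y) = (0 < y%:~R - x%:~R :> R) by rewrite subr_gt0 ltr_int.
move=> [[ab Xab]|[ba Xba]] [[cd Xcd]|[dc Xdc]].
- left; split; first by move: ab cd; rewrite !ltR H; nra.
  have ef : e < f by move: ab cd; rewrite !ltR H; nra.
  suff [_ h] : (Phi `\` Dyer_set X) (alpha e f) by apply: h.
  apply: (ccl (alpha a b) (alpha c d)).
  + by split=> //; exact: positive_alpha.
  + by split=> //; exact: positive_alpha.
  + exact: positive_alpha.
  + by exists s, t; rewrite !ltW.
- exact: (mixed a b c d s t).
- by apply: (mixed c d a b t s) => //; rewrite E addrC.
- have fe : f < e by move: ba dc; rewrite !ltR; nra.
  right; split=> //; apply: (cl _ _ _ Xba Xdc); first exact: positive_alpha.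
  exists s, t; rewrite !ltW//; split=> //.
  rewrite [alpha f e]alphaN E [alpha b a]alphaN [alpha d c]alphaN.
  by move: (alpha a b) (alpha c d) => A C; rewrite !scalerN opprD.
Qed.

Lemma dlt_trans X a b c : ~~ cong a b -> ~~ cong b c -> ~~ cong a c ->
  dlt X a b -> dlt X b c -> dlt X a c.
Proof.
move=> nab nbc nac; apply: (dlt_cone nab nbc nac ltr01 ltr01).
by rewrite !scale1r -alphaD.
Qed.

Lemma dlt_convexr X a b i j k : ~~ cong a b -> i < j -> j < k ->
  dlt X a (b + i * n%:Z) -> dlt X a (b + k * n%:Z) -> dlt X a (b + j * n%:Z).
Proof.
move=> nab ij jk.
have D0 : 0 < k%:~R - i%:~R :> R by rewrite subr_gt0 ltr_int; lia.
have D1 := lt0r_neq0 D0.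
(* Barycentric weights of [j] with respect to [i] and [k]. *)
pose s : R := (k%:~R - j%:~R) / (k%:~R - i%:~R).
pose t : R := (j%:~R - i%:~R) / (k%:~R - i%:~R).
have s0 : 0 < s by rewrite divr_gt0// subr_gt0 ltr_int.
have t0 : 0 < t by rewrite divr_gt0// subr_gt0 ltr_int.
have sE : s * (k%:~R - i%:~R) = k%:~R - j%:~R by rewrite divfK.
have tE : t * (k%:~R - i%:~R) = j%:~R - i%:~R by rewrite divfK.
have st : s + t = 1 by apply: (mulIf D1); rewrite mulrDl sE tE; lra.
have stj : s * i%:~R + t * k%:~R = j%:~R.
  by have -> : s = 1 - t by [lra]; move: tE; nra.
apply: (dlt_cone (s := s) (t := t)); rewrite ?cong_shiftr//.
rewrite !alpha_shiftr//; move: (alpha a b) (delta R n) => A d.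
by rewrite !scalerDr !scalerA addrACA -!scalerDl st stj scale1r.
Qed.

Lemma dlt_convexl X a b i j k : ~~ cong a b -> i < j -> j < k ->
  dlt X (b + i * n%:Z) a -> dlt X (b + k * n%:Z) a -> dlt X (b + j * n%:Z) a.
Proof.
move=> nab ij jk hi hk.
have sw l : ~~ cong a (b + l * n%:Z) by rewrite cong_shiftr.
apply/(dlt_compl X (sw j)); apply: (dlt_convexr nab ij jk).
  exact/(dlt_compl X (sw i)).
exact/(dlt_compl X (sw k)).
Qed.

(** A failure at some [j] would, by convexity between that shift and a known one, reverse one of the
    two given comparisons. *)
Lemma wane_extend X a d k : ~~ cong a d -> 0 < k ->
  dlt X (a + k * n%:Z) d -> dlt X d a ->
  (forall j, 0 <= j -> dlt X (d + j * n%:Z) a) /\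
  (forall j, k <= j -> dlt X a (d - j * n%:Z)).
Proof.
move=> nad k0 kd da.
have nadj j : ~~ cong a (d + j * n%:Z) by rewrite cong_shiftr.
have da0 : dlt X (d + 0 * n%:Z) a by rewrite mul0r addr0.
have adk : dlt X a (d + - k * n%:Z).
  by move/(dlt_shift (- k)): kd; rewrite -addrA -mulrDl subrr mul0r addr0.
split=> j hj.
  have [->//|j0] := eqVneq j 0.
  apply/dltNC => // adj; apply: (dlt_asym da0).
  by apply: (dlt_convexr nad _ _ adk adj); lia.
rewrite -mulNr; have [->//|jk] := eqVneq j k.
apply: dlt_flip; first by rewrite cong_sym.
move=> h; apply: (dlt_asym adk).
by apply: (dlt_convexl nad _ _ h da0); lia.
Qed.

Lemma wax_extend X a d k : ~~ cong a d -> 0 < k ->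
  dlt X a d -> dlt X d (a + k * n%:Z) ->
  (forall j, 0 <= j -> dlt X a (d + j * n%:Z)) /\
  (forall j, k <= j -> dlt X (d - j * n%:Z) a).
Proof.
move=> nad k0 ad dk.
have [||h1 h2] := @wane_extend (Dyer_compl X) a d k nad k0.
- by apply/dlt_compl => //; rewrite cong_shiftl.
- by apply/dlt_compl => //; rewrite cong_sym.
split=> j hj.
  by apply/dlt_compl; [rewrite cong_sym cong_shiftr|exact: h1].
by apply/dlt_compl; [rewrite -mulNr cong_shiftr|exact: h2].
Qed.

(** An incongruent [d] between [a + k n] and [a] forces every TITO with real inversion set [X] to
    decrease on the class of [a]. *)
Definition waning X a : Prop := exists d k,
  [/\ ~~ cong a d, 0 < k, dlt X (a + k * n%:Z) d & dlt X d a].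

Lemma waning_shift l X a : waning X a -> waning X (a + l * n%:Z).
Proof.
move=> [d [k [nad k0 kd da]]]; exists (d + l * n%:Z), k.
rewrite cong_shiftl cong_shiftr addrAC; split=> //; exact/dlt_shift.
Qed.

Lemma waning_cong X a b : cong a b -> waning X a <-> waning X b.
Proof.
move=> /congP[k ->]; split; first exact: waning_shift.
by move=> /(waning_shift (- k)); rewrite mulNr addrK.
Qed.

Lemma not_waning X a d k : ~~ cong a d -> 0 < k ->
  dlt X a d -> dlt X d (a + k * n%:Z) -> ~ waning X a.
Proof.
move=> nad k0 ad dk [d' [k' [nad' k'0 k'd' d'a]]].
have [h1 h2] := wax_extend nad k0 ad dk.
have [h1' h2'] := wane_extend nad' k'0 k'd' d'a.
have [dd'|ndd'] := boolP (cong d d').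
  have /congP[m em] := dd'; rewrite em in h1'.
  have [m0|m0] := lerP 0 m.
    apply: (dlt_asym (h1 m m0)).
    by have := h1' 0 (lexx _); rewrite mul0r addr0.
  apply: (dlt_asym (h1 0 (lexx _))).
  have m1 : 0 <= - m by lia.
  by have := h1' _ m1; rewrite mulNr addrK mul0r addr0.
have nd'd : ~~ cong d' d by rewrite cong_sym.
have nd'a : ~~ cong d' a by rewrite cong_sym.
have nda : ~~ cong d a by rewrite cong_sym.
apply: (dlt_asym (dlt_trans nd'a nad nd'd d'a ad)).
(* A shift past both thresholds swaps the sides of [a] on which [d] and [d'] lie, so [d] precedes
   [d'] as well as following it. *)
pose K := k + k'.
have dK : dlt X (d - K * n%:Z) a by apply: h2; rewrite /K; lia.
have d'K : dlt X a (d' - K * n%:Z) by apply: h2'; rewrite /K; lia.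
rewrite -!mulNr in dK d'K; apply/(dlt_shift (- K)).
apply: dlt_trans dK d'K; by rewrite ?cong_shiftl ?cong_shiftr.
Qed.

(* The least TITO with real inversion set [X]: a residue class is decreasing
   only when [dlt X] forces it to be. *)
Definition slt X a b : Prop :=
  (~~ cong a b /\ dlt X a b) \/
  (cong a b /\ ((waning X a /\ b < a) \/ (~ waning X a /\ a < b))).

Lemma cong_lt a b : a < b -> cong a b -> exists2 k, 0 < k & b = a + k * n%:Z.
Proof.
move=> ab /congP[k bk]; exists k => //; move: ab.
by rewrite bk ltrDl pmulr_lgt0// ltz_nat.
Qed.

(** An incongruent integer between two members of a class decides whether the class wanes. This
    gives the direction when only the ends are congruent, and a contradiction when a mixed case
    fails. *)
Lemma slt_trans X a b c : slt X a b -> slt X b c -> slt X a c.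
Proof.
move=> [[nab ab]|[ab hab]] [[nbc bc]|[bc hbc]].
- have [ac|nac] := boolP (cong a c); last by left; split=> //; exact: dlt_trans bc.
  right; split=> //; have [lac|lca|eac] := ltgtP a c.
  + have [k k0 ck] := cong_lt lac ac; rewrite ck in bc.
    by right; split=> //; exact: not_waning bc.
  + rewrite cong_sym in ac; have [k k0 ak] := cong_lt lca ac.
    left; split=> //; apply/(waning_cong _ ac); exists b, k.
    by split=> //; [rewrite cong_sym|rewrite -ak].
  + by rewrite eac in ab; case: (dlt_asym ab bc).
- have nac : ~~ cong a c.
    by apply: contraNN nab => ac; apply: cong_trans ac _; rewrite cong_sym.
  have nca : ~~ cong c a by rewrite cong_sym.
  left; split=> //; apply/(dltNC _ nca) => ca.
  case: hbc => -[w lbc].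
    rewrite cong_sym in bc; have [k k0 bk] := cong_lt lbc bc; rewrite bk in ab.
    by case: (not_waning nca k0 ca ab); apply/(waning_cong _ bc).
  have [k k0 ck] := cong_lt lbc bc; apply: w; exists a, k.
  by split=> //; [rewrite cong_sym|rewrite -ck].
- have nac : ~~ cong a c.
    by apply: contraNN nbc; apply: cong_trans; rewrite cong_sym.
  have nca : ~~ cong c a by rewrite cong_sym.
  left; split=> //; apply/(dltNC _ nca) => ca.
  case: hab => -[w lab].
    rewrite cong_sym in ab; have [k k0 ak] := cong_lt lab ab; rewrite ak in ca.
    by case: (not_waning nbc k0 bc ca); apply/(waning_cong _ ab).
  have [k k0 bk] := cong_lt lab ab; apply: w; exists c, k.
  by split=> //; rewrite -bk.
right; split; first exact: cong_trans bc.
have E := waning_cong X ab.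
case: hab => -[wa lab]; case: hbc => -[wb lbc].
- by left; split=> //; exact: lt_trans lab.
- by case: wb; apply/E.
- by case: wa; apply/E.
- by right; split=> //; exact: lt_trans lbc.
Qed.

Lemma slt_irr X a : ~ slt X a a.
Proof. by case=> [[]|[_ [[_]|[_]]]]; rewrite ?cong_refl ?ltxx. Qed.

Lemma slt_total X a b : a != b -> slt X a b \/ slt X b a.
Proof.
move=> neq; have [ab|nab] := boolP (cong a b); last first.
  have [h|/(dlt_flip nab) h] := pselect (dlt X a b); [left|right]; left=> //.
  by rewrite cong_sym.
have E := waning_cong X ab; have ba : cong b a by rewrite cong_sym.
move: neq; rewrite neq_lt; have [w|w] := pselect (waning X a) => /orP[l|l].
- by right; right; split=> //; left; split=> //; apply/E.
- by left; right; split=> //; left.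
- by left; right; split=> //; right.
- by right; right; split=> //; right; split=> // /E.
Qed.

Lemma slt_shift l X a b : slt X a b -> slt X (a + l * n%:Z) (b + l * n%:Z).
Proof.
have E : waning X (a + l * n%:Z) <-> waning X a.
  by apply: waning_cong; rewrite cong_shiftl cong_refl.
rewrite /slt cong_shiftl cong_shiftr !ltrD2r => -[[nab ab]|[ab h]].
  by left; split=> //; exact/dlt_shift.
right; split=> //; case: h => -[w lt]; [left|right]; split=> //; first exact/E.
by move/E.
Qed.

Lemma exists_TTot_slt X : exists p : TTot n, forall a b, p a b <-> slt X a b.
Proof.
have [p pE] := exists_Tot_rel (@slt_irr X) (@slt_trans X) (@slt_total X).
have [|q qp] := @exists_TTot n p; last by exists q => a b; rewrite qp pE.
move=> a b; apply/idP/idP => /pE h; apply/pE.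
  by have := slt_shift 1 h; rewrite mul1r.
by have := slt_shift (-1) h; rewrite mulN1r !addrK.
Qed.

Definition least_TTot X : TTot n := projT1 (cid (exists_TTot_slt X)).

Lemma least_TTotE X a b : least_TTot X a b <-> slt X a b.
Proof. exact: (projT2 (cid (exists_TTot_slt X))). Qed.

Lemma inv_least_TTot X a b :
  ~~ cong a b -> inv (least_TTot X) a b <-> dinv X a b.
Proof.
move=> nab; split=> [[/= ab /least_TTotE h]|[ab _ Xab]].
  case: h => [[nba [[/(lt_trans ab)]|[_ Xab]]]|[ba _]]; rewrite ?ltxx//.
  by rewrite cong_sym (negbTE nab) in ba.
split=> //=; apply/least_TTotE; left; rewrite cong_sym; split=> //.
by right.
Qed.

Lemma least_TTotK : cancel least_TTot Dyer_of_TTot.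
Proof.
move=> X; apply: dinv_eq => a b; rewrite dinv_Dyer_of_TTot; split.
  by move=> [h nab]; apply/inv_least_TTot.
by move=> h; have [_ nab _] := h; split=> //; apply/inv_least_TTot.
Qed.

(** * The two adjoints of [Dyer_of_TTot], and joins of biclosed sets *)

Lemma le_TTot_inv (p q : TTot n) :
  (p <= q)%O <-> (forall a b, inv p a b -> inv q a b).
Proof. by rewrite TTot_leE; split=> [h a b|h [a b]]; apply: h. Qed.

Lemma Dyer_of_TTot_le (p q : TTot n) :
  (p <= q)%O -> (Dyer_of_TTot p <= Dyer_of_TTot q)%O.
Proof.
move=> /le_TTot_inv pq; apply/le_dinv => a b /dinv_Dyer_of_TTot[pab nab].
by apply/dinv_Dyer_of_TTot; split=> //; exact: pq.
Qed.

Lemma least_TTotP X (p : TTot n) :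
  (least_TTot X <= p)%O <-> (X <= Dyer_of_TTot p)%O.
Proof.
split=> [/Dyer_of_TTot_le|Xp]; first by rewrite least_TTotK.
have Xinv a b : dinv X a b -> inv p a b.
  by move/le_dinv: Xp => h /h /dinv_Dyer_of_TTot[].
apply/le_TTot_inv => a b h.
have [ab|nab] := boolP (cong a b); last by apply/Xinv/inv_least_TTot.
have lab := inv_lt h; have [k k0 bk] := cong_lt lab ab.
have wb : waning X b.
  case: h => _ /= /least_TTotE[[]|[_ [[w _]//|[_]]]]; first by rewrite cong_sym ab.
  by move=> /(lt_trans lab); rewrite ltxx.
have {wb} [d [l [nad l0 ld da]]] : waning X a by apply/(waning_cong _ ab).
have [h1 h2] := wane_extend nad l0 ld da.
(* Only inversions pass from [X] to [p]. This [j] moves [d] far enough that its comparisons with [a]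
   at both [d + j n] and [d - j n] are inversions. *)
pose j : int := l + `|a - d|.
have jn : j <= j * n%:Z by apply: ler_peMr; [rewrite /j; lia|rewrite lez_nat].
have j1 : a < d + j * n%:Z by rewrite /j in jn *; lia.
have j2 : d - j * n%:Z < a by rewrite /j in jn *; lia.
have hj1 : dlt X (d + j * n%:Z) a by apply: h1; rewrite /j; lia.
have hj2 : dlt X a (d - j * n%:Z) by apply: h2; rewrite /j; lia.
have p1 : p (d + j * n%:Z) a.
  have [] // : inv p a (d + j * n%:Z).
  apply: Xinv; split=> //; first by rewrite cong_shiftr.
  by case: hj1 => -[]// /(lt_trans j1); rewrite ltxx.
have p2 : p a (d - j * n%:Z).
  have [] // : inv p (d - j * n%:Z) a.
  apply: Xinv; split=> //; first by rewrite -mulNr cong_shiftl cong_sym.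
  by case: hj2 => -[]// /(lt_trans j2); rewrite ltxx.
(* Translating [p2] by [2 j n] puts [a + 2 j n] before [d + j n], which [p1] puts before [a]. *)
have p4 : p (a + (j + j) * n%:Z) a.
  apply: Tot_trans p1; rewrite mulrDl addrA (TTot_shiftM n_gt0).
  by rewrite -(TTot_shiftM n_gt0 _ (- j)) mulNr addrK.
split=> //=; rewrite bk; apply: TTot_wane => //.
by apply: (TTot_waneI n_gt0 p4); rewrite /j; lia.
Qed.

Definition greatest_TTot X : TTot n := TTot_converse (least_TTot (Dyer_compl X)).

Let dinv_lt X a b : dinv X a b -> a < b. Proof. by case. Qed.
Let dinv_ncong X a b : dinv X a b -> ~~ cong a b. Proof. by case. Qed.

Let compl_le X Y : (Dyer_compl X <= Dyer_compl Y)%O = (Y <= X)%O :=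
  le_I_rev dinv_lt dinv_ncong le_dinv dinv_compl X Y.

Let complK : involutive Dyer_compl :=
  I_revK dinv_lt dinv_ncong le_dinv dinv_compl.

Lemma TTot_converse_le (p q : TTot n) :
  (p <= q)%O -> (TTot_converse q <= TTot_converse p)%O.
Proof.
move=> /le_TTot_inv pq; apply/le_TTot_inv => a b /(inv_converse q)[ab _ nq].
by apply/(inv_converse p); split=> // /pq.
Qed.

Lemma TTot_converseK : involutive (@TTot_converse n).
Proof. by move=> p; apply/val_inj/val_inj. Qed.

Lemma greatest_TTotP X (p : TTot n) :
  (Dyer_of_TTot p <= X)%O <-> (p <= greatest_TTot X)%O.
Proof.
rewrite -compl_le -Dyer_of_TTot_converse -least_TTotP.
by split=> /TTot_converse_le; rewrite ?TTot_converseK.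
Qed.

Lemma Dyer_sup (A : set D) : exists2 U, supremums A U &
  forall a b, dinv U a b <->
    ~~ cong a b /\ clos_trans _ (fun a b => exists2 X, A X & dinv X a b) a b.
Proof.
have [[cT _] _] := TTot_profinite_semidistributive n.
have [[u u_sup] _] := cT (least_TTot @` A).
have iu := inv_TTot_sup u_sup.
exists (Dyer_of_TTot u).
  have [u_ub u_lub] := u_sup; split=> [X AX|Y Y_ub].
    by apply/least_TTotP/u_ub/imageP.
  rewrite -[Y]least_TTotK; apply/Dyer_of_TTot_le/u_lub => _ [X AX <-].
  by apply/least_TTotP; rewrite least_TTotK; exact: Y_ub.
move=> a b; rewrite dinv_Dyer_of_TTot; split=> [[/iu h nab]|[nab h]]; split=> //.
  (* The join of TITOs may use congruent steps, on which [X] has no roots; they are removed before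
     projecting. *)
  have {h} := clos_trans_real n_gt0 h nab.
  elim=> {a b nab} [a b [[_ [X AX <-] ab] nab]|a c b _ ac _]; last exact: t_trans.
  by apply: t_step; exists X => //; apply/inv_least_TTot.
apply/iu; elim: h {nab} => {a b} [a b [X AX ab]|a c b _ ac _]; last exact: t_trans.
apply: t_step; exists (least_TTot X); first exact: imageP.
by apply/inv_least_TTot => //; exact: dinv_ncong ab.
Qed.

Lemma Dyer_profinite_semidistributive : profinite_semidistributive_lattice D.
Proof.
have [cD pD] := profinite_inversions dinv_lt dinv_ncong le_dinv dinv_compl Dyer_sup.
split=> //; apply: (semidistributive_of_join complK compl_le cD).
have [[cT _] _] := TTot_profinite_semidistributive n.
apply: (join_semidistributive_retract least_TTotP greatest_TTotP least_TTotK cT).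
exact: join_semidistributive_TTot.
Qed.

End DyerPoset.

Theorem theorem1p1 (R : realType) (n : nat) (n_gt0 : (0 < n)%N) :
  [/\ profinite_semidistributive_lattice Tot,
      profinite_semidistributive_lattice (TTot n) &
      profinite_semidistributive_lattice (Dyer R n)].
Proof.
split.
- exact: Tot_profinite_semidistributive.
- exact: TTot_profinite_semidistributive.
- exact: Dyer_profinite_semidistributive.
Qed.
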